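(* Let $\Omega\subset\mathbb{C}^m$ be a Carathéodory hyperbolic domain, let $z_1,\ldots,z_n\in\Omega$ be mutually distinct points, $\underline{z}=(z_1,\ldots,z_n)$, and let $\underline{w}=(w_1,\ldots,w_n)\in\mathbb{D}^n$. The Pick interpolation problem $\Omega\ni z_j\mapsto w_j\in\mathbb{D}$, $1\le j\le n$, is solvable (i.e. there is $f\in\mathcal{O}(\Omega,\mathbb{D})$ with $f(z_j)=w_j$ for all $j$) if and only if one of the following two conditions holds: (1) $w_1=\cdots=w_n$; (2) for at least one pair $(i,j)$ one has $w_i\ne w_j$ and $m(w_i,w_j)\le d^{\Omega}_{(\underline{z},\underline{w})}(z_i,z_j)$. Moreover, when $\Omega=\mathbb{D}$, equality holds in (2) (that is, $m(w_i,w_j)= d^{\mathbb{D}}_{(\underline{z},\underline{w})}(z_i,z_j)$ for a pair $(i,j)$ with $w_i\neq w_j$) if and only if there is a non-constant Blaschke product of degree at most $n-1$ solving the problem.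
   Context: $\mathbb{D}$ is the open unit disc in $\mathbb{C}$; $\mathcal{O}(X,Y)$ is the set of holomorphic maps $X\to Y$. For $u,v\in\mathbb{D}$, $m(u,v)=\left|\frac{u-v}{1-\overline{u}v}\right|$. A domain $\Omega\subset\mathbb{C}^m$ ($m\ge1$) is Carathéodory hyperbolic if $c^*_\Omega(z,w)=\sup\{m(g(z),g(w)):g\in\mathcal{O}(\Omega,\mathbb{D})\}>0$ for all distinct $z,w\in\Omega$. For $\underline{z}=(z_1,\ldots,z_n)\in\Omega^n$ and $\underline{\alpha}\in\mathbb{C}^n\setminus\{\mathbf 0\}$ define $$d^{\Omega}_{(\underline{z},\underline{\alpha})}(z_i,z_j)=\sup\{m(f(z_i),f(z_j)): f\in\mathcal{O}(\Omega,\mathbb{D}),\ (f(z_1),\ldots,f(z_n))\in\mathbb{C}\cdot\underline{\alpha}\},$$ where $\mathbb{C}\cdot\underline{\alpha}$ is the one-dimensional subspace of $\mathbb{C}^n$ spanned by $\underline{\alpha}$. *)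

(* Defs.v *)
From HB Require Import structures.
From mathcomp Require Import all_boot all_order all_algebra.
From mathcomp Require Import all_classical all_reals all_analysis.
From mathcomp Require Import complex.

Set Implicit Arguments.
Unset Strict Implicit.
Unset Printing Implicit Defensive.

Import Order.TTheory GRing.Theory Num.Theory.
Import numFieldNormedType.Exports.

Local Open Scope classical_set_scope.
Local Open Scope ring_scope.

(* [R[i]] gets its topology and its normed-module structure over itself through
   the alias [R[i]^o]; [V] below is instantiated with ['rV[R[i]]_m] (that is,
   C^m) and with [R[i]^o] (that is, C). *)

Definition disc (R : realType) : set R[i] := [set z | `|z| < 1].

Definition domain (R : realType) (V : normedModType R[i]) (Omega : set V) :=
  [/\ Omega !=set0, open Omega & connected Omega].

(* Functions are total; [hol_disc Omega f] only constrains [f] on [Omega], which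
   is meant to be open.  [differentiable] is complex Frechet differentiability,
   [V] being a normed module over [R[i]]. *)
Definition hol_disc (R : realType) (V : normedModType R[i]) (Omega : set V) :
    set (V -> R[i]) :=
  [set f | (forall x, Omega x -> differentiable (f : V -> R[i]^o) x) /\
           (forall x, Omega x -> disc (f x))].

(* The norm of [R[i]] takes its values in [R[i]] (on the real axis); [complex.Re]
   brings it back to [R], where suprema are taken.  [complex.Re] is qualified
   because [Re] is shadowed by the one of the number-field library. *)
Definition mobius (R : realType) (u v : R[i]) : R :=
  complex.Re `|(u - v) / (1 - u^* * v)|.

Definition caratheodory (R : realType) (V : normedModType R[i])
    (Omega : set V) (z w : V) : R :=
  sup [set mobius (g z) (g w) | g in hol_disc Omega].

Definition caratheodory_hyperbolic (R : realType) (V : normedModType R[i])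
    (Omega : set V) :=
  forall z w, Omega z -> Omega w -> z <> w -> 0 < caratheodory Omega z w.

(* The last condition says that (f (z_1), ..., f (z_n)) lies in C . alpha.  The set
   contains 0 (take f = 0) and is bounded by 1, so [sup] is a true supremum. *)
Definition pick_dist (R : realType) (V : normedModType R[i]) (Omega : set V)
    (n : nat) (z : 'I_n -> V) (alpha : 'I_n -> R[i]) (i j : 'I_n) : R :=
  sup [set mobius (f (z i)) (f (z j)) | f in
         [set f | hol_disc Omega f /\
                  exists c : R[i], forall k, f (z k) = c * alpha k]].

Definition pick_solvable (R : realType) (V : normedModType R[i]) (Omega : set V)
    (n : nat) (z : 'I_n -> V) (w : 'I_n -> R[i]) :=
  exists f, hol_disc Omega f /\ forall j, f (z j) = w j.

(* Finite Blaschke product of degree [k], constrained only on the disc. *)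
Definition blaschke (R : realType) (k : nat) (B : R[i] -> R[i]) :=
  exists (c : R[i]) (a : 'I_k -> R[i]),
    [/\ `|c| = 1, forall l, disc (a l) &
        forall x, disc x ->
          B x = c * \prod_(l < k) ((x - a l) / (1 - (a l)^* * x))].

(* Main.v *)
Require Import Defs.
From HB Require Import structures.
From mathcomp Require Import all_boot all_order all_algebra.
From mathcomp Require Import all_classical all_reals all_analysis.
From mathcomp Require Import complex.
From mathcomp Require Import ring lra.

(** Why the theorem holds.

    An admissible function [f] in the definition of [pick_dist] sends the nodes
    to [c * w k] for some scalar [c], and shrinking two points of the disc by a
    factor of modulus below 1 shrinks their Moebius distance, uniformly while
    the modulus stays away from 1 ([mobius_contract]).  A solution of the
    problem is admissible with [c = 1], which gives one implication.
    Conversely, if the distance of [w i] and [w j] is at most [pick_dist], then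
    functions close to the supremum must have [c] of modulus nearly 1 or larger,
    so that [t * w] is interpolated for every [t < 1] ([scaled_solvable]).  A
    normal family argument ([montel_disc]) lets [t] tend to 1; the limit takes
    values in the closed disc, hence in the open one, because a holomorphic
    function on a connected set that touches the circle is unimodular
    throughout ([disc_valued]).

    On the unit disc, equality means exactly that no interpolating function is
    bounded by a constant below 1: such a function could be enlarged
    ([strict_solution_lt]).  Schur's algorithm decides this.  Composing with the
    automorphism that moves the value at the first node to 0, and dividing by
    the Blaschke factor of that node, removes a node while preserving both
    solvability by functions bounded by 1 and the absence of a strictly bounded
    solution.  It can only end with a unimodular constant, and going back up
    every removed node contributes one factor ([schur_algorithm]).  Conversely,
    running the same reduction on a Blaschke product with fewer factors than
    nodes together with a strictly bounded function that agrees with it at the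
    nodes exhausts the factors first, and leaves a constant of modulus 1 equal
    to a number of modulus below 1 ([blaschke_not_strict]).

    The function theory is built from complex differentiability alone.
    Goursat's bisection ([boundary_int_eq0]), used in exponential polar
    coordinates, shows that circle means do not depend on the radius, so that a
    real part has no strict peak at a point where the function is merely
    continuous ([no_strict_peak]).  This yields the maximum principle and
    Schwarz's lemma.  Schwarz's lemma applied to difference quotients controls
    the second-order Taylor remainder by the bound on the function
    ([quadratic_estimate]).  That single estimate gives the removability of
    point singularities, on which the division step of Schur's algorithm relies,
    and, applied along complex lines, the stability of holomorphy under bounded
    pointwise limits in any normed space.  Limits are taken along an ultrafilter
    on the integers, so that no subsequence has to be extracted. *)

Set Implicit Arguments.
Unset Strict Implicit.
Unset Printing Implicit Defensive.

Import Order.TTheory GRing.Theory Num.Theory.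
Import numFieldNormedType.Exports.

Local Open Scope classical_set_scope.
Local Open Scope ring_scope.

(** * Moduli, continuity and differentiability with real tolerances *)

Section Modulus.
Variable R : realType.
Local Notation C := R[i].

(** Norms over [R[i]] take values in [R[i]], where the order is partial.
    Their real part lives in [R], where linear arithmetic is available. *)
Definition modulus (V : normedZmodType C) (x : V) : R := complex.Re `|x|.
Local Notation N := modulus.

Lemma normC_modulus (V : normedZmodType C) (x : V) : `|x| = real_complex R (N x).
Proof. by rewrite /modulus RRe_real ?normr_real. Qed.

Lemma modulus_ge0 (V : normedZmodType C) (x : V) : 0 <= N x.
Proof. by rewrite -ler0c -normC_modulus. Qed.

Lemma modulus0 (V : normedZmodType C) : N (0 : V) = 0.
Proof. by apply: complexI; rewrite -normC_modulus normr0. Qed.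

Lemma modulus_eq0 (V : normedZmodType C) (x : V) : (N x == 0) = (x == 0).
Proof.
by rewrite -(normr_eq0 x) normC_modulus -(inj_eq (@complexI R)).
Qed.

Lemma modulus_gt0 (V : normedZmodType C) (x : V) : (0 < N x) = (x != 0).
Proof. by rewrite lt0r modulus_eq0 modulus_ge0 andbT. Qed.

Lemma modulusD (V : normedZmodType C) (x y : V) : N (x + y) <= N x + N y.
Proof. by rewrite -lecR rmorphD/= -!normC_modulus ler_normD. Qed.

Lemma modulusN (V : normedZmodType C) (x : V) : N (- x) = N x.
Proof. by rewrite /modulus normrN. Qed.

Lemma modulusBC (V : normedZmodType C) (x y : V) : N (x - y) = N (y - x).
Proof. by rewrite /modulus distrC. Qed.

Lemma modulusB (V : normedZmodType C) (x y : V) : N (x - y) <= N x + N y.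
Proof. by rewrite -(modulusN y) modulusD. Qed.

Lemma modulusBr (V : normedZmodType C) (x y : V) : N x - N y <= N (x - y).
Proof. by have := modulusD (x - y) y; rewrite subrK; lra. Qed.

Lemma modulusZ (V : normedModType C) (a : C) (x : V) : N (a *: x) = N a * N x.
Proof. by apply: complexI; rewrite rmorphM/= -!normC_modulus normrZ. Qed.

Lemma modulusM (x y : C) : N (x * y) = N x * N y.
Proof. by apply: complexI; rewrite rmorphM/= -!normC_modulus normrM. Qed.

Lemma modulusV (x : C) : N x^-1 = (N x)^-1.
Proof. by apply: complexI; rewrite fmorphV/= -!normC_modulus normfV. Qed.

Lemma modulus_conj (x : C) : N x^* = N x.
Proof. by rewrite /modulus norm_conjC. Qed.

Lemma modulus1 : N (1 : C) = 1.
Proof. by apply: complexI; rewrite -normC_modulus normr1. Qed.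

Lemma modulusR (r : R) : N (real_complex R r : C) = `|r|.
Proof.
by rewrite /modulus normc_def/= expr0n/= addr0 sqrtr_sqr.
Qed.

Lemma modulus_sqr (x : C) : N x ^+ 2 = complex.Re x ^+ 2 + complex.Im x ^+ 2.
Proof.
by apply: complexI; rewrite rmorphXn/= -normC_modulus -add_Re2_Im2.
Qed.

Lemma modulus_conjM (x : C) : x * x^* = real_complex R (N x ^+ 2).
Proof. by rewrite -normCK rmorphXn/= -normC_modulus. Qed.

Lemma complex_ReD (x y : C) : complex.Re (x + y) = complex.Re x + complex.Re y.
Proof. by case: x; case: y. Qed.

Lemma complex_ReB (x y : C) : complex.Re (x - y) = complex.Re x - complex.Re y.
Proof. by case: x; case: y. Qed.

Lemma complex_ImB (x y : C) : complex.Im (x - y) = complex.Im x - complex.Im y.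
Proof. by case: x; case: y. Qed.

Lemma Re_le_modulus (x : C) : `|complex.Re x| <= N x.
Proof. by rewrite -lecR -normC_modulus normc_ge_Re. Qed.

Lemma Im_le_modulus (x : C) : `|complex.Im x| <= N x.
Proof.
rewrite -(ler_pXn2r (n := 2)) ?nnegrE ?modulus_ge0// modulus_sqr real_normK ?num_real//.
by have := sqr_ge0 (complex.Re x); lra.
Qed.

Lemma modulus_le_ReIm (x : C) : N x <= `|complex.Re x| + `|complex.Im x|.
Proof.
rewrite -(ler_pXn2r (n := 2)) ?nnegrE ?modulus_ge0 ?addr_ge0// modulus_sqr.
rewrite sqrrD !real_normK ?num_real//.
have : 0 <= `|complex.Re x| * `|complex.Im x| by rewrite mulr_ge0.
lra.
Qed.

Lemma discE (z : C) : disc z <-> N z < 1.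
Proof. by rewrite /disc/= normC_modulus -ltcR. Qed.

(** The next three lemmas trade filters and Landau notation for real epsilons
    and deltas, the form in which all estimates below are stated. *)
Lemma nbhs_modulusP (V : normedModType C) (x : V) (P : set V) :
  nbhs x P <-> exists2 d : R, 0 < d & forall y, N (y - x) < d -> P y.
Proof.
split.
  move=> /nbhs_normP[e /= e0 eP].
  have er : e = real_complex R (complex.Re e).
    by rewrite RRe_real// realE ltW.
  exists (complex.Re e) => [|y yx].
    by rewrite -ltcR -er.
  apply: eP; rewrite /= er distrC normC_modulus.
  by rewrite ltcR.
move=> [d d0 dP]; apply/nbhs_normP; exists (real_complex R d).
  by rewrite /= ltcR.
move=> y /=; rewrite distrC normC_modulus ltcR; exact: dP.
Qed.

Lemma continuous_modulusP (V W : normedModType C) (f : V -> W) x :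
  {for x, continuous f} <-> forall e : R, 0 < e ->
    exists2 d : R, 0 < d & forall y, N (y - x) < d -> N (f y - f x) < e.
Proof.
split=> [fx e e0|H].
  apply/(nbhs_modulusP x [set y | N (f y - f x) < e]).
  apply: (fx [set z | N (z - f x) < e]).
  by apply/nbhs_modulusP; exists e.
move=> P /nbhs_modulusP[e e0 eP].
have [d d0 dP] := H _ e0.
by apply/nbhs_modulusP; exists d => // y /dP/eP.
Qed.

Lemma differentiable_modulusP (V W : normedModType C) (f : V -> W) x :
  differentiable f x <-> exists L : {linear V -> W},
    (exists K : R, forall h, N (L h) <= K * N h) /\
    forall e : R, 0 < e -> exists2 d : R, 0 < d &
      forall h, N h < d -> N (f (x + h) - f x - L h) <= e * N h.
Proof.
split.
  move=> /diff_locallyP[cd fx].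
  exists ('d f x); split.
    have [d d0 dP] := (continuous_modulusP _ 0).1 (cd 0) 1 ltr01.
    exists (2 * d^-1) => h; have [->|h0] := eqVneq h 0.
      by rewrite linear0 !modulus0 mulr0.
    have Nh : 0 < N h by rewrite modulus_gt0.
    set t : C := real_complex R (d / 2 / N h).
    have tN : N t = d / 2 / N h by rewrite modulusR ger0_norm// !divr_ge0 ?modulus_ge0 ?ltW.
    have := dP (t *: h); rewrite subr0 modulusZ tN divfK ?gt_eqF//.
    rewrite (linear0 ('d f x)) subr0 linearZ modulusZ tN.
    move=> /(_ ltac:(lra)) H.
    have := ltW H; rewrite -ler_pdivlMl; last by rewrite !divr_gt0.
    by rewrite mulr1 !invfM !invrK; lra.
  move=> e e0.
  have : \forall h \near (0 : V), `|f (h + x) - (f x + 'd f x h)| <= real_complex R e * `|h|.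
    by have /eqaddoP/(_ (real_complex R e)) := fx; apply; rewrite ltcR.
  move=> /nbhs_modulusP[d d0 dP]; exists d => // h hd.
  have := dP h; rewrite subr0 => /(_ hd).
  by rewrite !normC_modulus -rmorphM/= lecR [h + x]addrC opprD addrA.
move=> [L [[K LK] H]].
have K1 : 0 < `|K| + 1 by rewrite ltr_wpDl.
have cL : continuous L.
  move=> y; apply/continuous_modulusP => e e0; exists (e / (`|K| + 1)).
    by rewrite divr_gt0.
  move=> z; rewrite ltr_pdivlMr// -linearB => zy.
  apply: le_lt_trans (LK _) _; apply: le_lt_trans zy.
  rewrite mulrC ler_wpM2l ?modulus_ge0//.
  by have := ler_norm K; lra.
have Hd : f \o shift x = cst (f x) + L +o_ (0:V) id.
  apply/eqaddoP => e e0 /=.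
  have er : e = real_complex R (complex.Re e) by rewrite RRe_real// realE ltW.
  have [d d0 dP] := H (complex.Re e) ltac:(by rewrite -ltcR -er).
  apply/nbhs_modulusP; exists d => // h; rewrite subr0 => /dP hd.
  change (`|f (h + x) - (f x + L h)| <= e * `|h|).
  by rewrite [h + x]addrC opprD addrA !normC_modulus er -rmorphM/= lecR.
by have dE := diff_unique cL Hd; apply/diff_locallyP; rewrite dE.
Qed.

Definition holo_at (V : normedModType C) (f : V -> C) (x : V) : Prop :=
  differentiable (f : V -> C^o) x.

End Modulus.

(** * Goursat's theorem for closed forms on a rectangle *)

Section Goursat.
Variable R : realType.

Definition cont_on (f : R -> R) (a b : R) :=
  forall x, a <= x <= b -> {for x, continuous f}.

Definition segint (f : R -> R) (a b : R) : R :=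
  (\int[lebesgue_measure]_(x in `[a, b]) f x)%R.

Lemma cont_on_integrable f a b : cont_on f a b ->
  (@lebesgue_measure R).-integrable `[a, b]%classic (EFin \o f).
Proof.
move=> cf; apply: continuous_compact_integrable; first exact: segment_compact.
apply: continuous_in_subspaceT => x; rewrite inE/= in_itv/=; exact: cf.
Qed.

Lemma segintD f a b c : a <= b -> b <= c -> cont_on f a c ->
  segint f a c = segint f a b + segint f b c.
Proof.
move=> ab bc cf; have fi := cont_on_integrable cf.
have := Rintegral_itvB fi (x := b).
rewrite !bnd_simp => /(_ ab bc); rewrite /segint.
rewrite Rintegral_itv_obnd_cbnd; last first.
  by apply: integrableS fi => //; apply: subset_itv; rewrite bnd_simp.
by move=> <-; rewrite addrC subrK.
Qed.

Lemma segintB f g a b : cont_on f a b -> cont_on g a b ->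
  segint (fun x => f x - g x) a b = segint f a b - segint g a b.
Proof. by move=> cf cg; apply: RintegralB => //; apply: cont_on_integrable. Qed.

Lemma segint_cst (k a b : R) : a <= b -> segint (fun=> k) a b = k * (b - a).
Proof.
move=> ab; rewrite /segint Rintegral_cst//.
rewrite /= lebesgue_measure_itv/= lte_fin; have [_//|ba] := ltP a b.
by have -> : a = b; [lra | rewrite subrr].
Qed.

Lemma segint_le f g a b : cont_on f a b -> cont_on g a b ->
  (forall x, a <= x <= b -> f x <= g x) -> segint f a b <= segint g a b.
Proof.
move=> cf cg fg; apply: le_Rintegral; [by []|exact: cont_on_integrable..|].
by move=> x /=; rewrite in_itv/=; apply: fg.
Qed.

Lemma cont_on_cst (k a b : R) : cont_on (fun=> k) a b.
Proof. by move=> x _; apply: cvg_cst. Qed.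

Lemma cont_onB f g a b : cont_on f a b -> cont_on g a b ->
  cont_on (fun x => f x - g x) a b.
Proof. by move=> cf cg x xab; apply: (continuousB (cf x xab) (cg x xab)). Qed.

Lemma segint_close f a b m e : a <= b -> cont_on f a b ->
  (forall x, a <= x <= b -> `|f x - m| <= e) ->
  `|segint f a b - m * (b - a)| <= e * (b - a).
Proof.
move=> ab cf fm.
have H1 : segint f a b <= segint (fun=> m + e) a b.
  apply: segint_le => // [|x /fm]; first exact: cont_on_cst.
  by rewrite ler_distl; lra.
have H2 : segint (fun=> m - e) a b <= segint f a b.
  apply: segint_le => // [|x /fm]; first exact: cont_on_cst.
  by rewrite ler_distl; lra.
by move: H1 H2; rewrite !segint_cst// ler_distl !mulrDl; lra.
Qed.

(** The one-form [P dx + Q dy] is closed at a point: both coefficients are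
    differentiable there, and the shared [b] says that the partial derivative of
    [P] in [y] equals that of [Q] in [x].  Nothing is asked of the derivatives
    at other points, so continuity of the derivative is never assumed. *)
Definition closed_form_at (P Q : R -> R -> R) (x y : R) :=
  exists a b c : R, forall e : R, 0 < e -> exists2 d : R, 0 < d &
    forall h k : R, `|h| < d -> `|k| < d ->
      `|P (x + h) (y + k) - P x y - (a * h + b * k)| <= e * (`|h| + `|k|) /\
      `|Q (x + h) (y + k) - Q x y - (b * h + c * k)| <= e * (`|h| + `|k|).

Definition boundary_int (P Q : R -> R -> R) (a c w h : R) : R :=
  (segint (P^~ c) a (a + w) - segint (P^~ (c + h)) a (a + w)) +
  (segint (Q (a + w)) c (c + h) - segint (Q a) c (c + h)).

Lemma continuous_realP (f : R -> R) x :
  (forall e : R, 0 < e -> exists2 d : R, 0 < d & forall h, `|h| < d -> `|f (x + h) - f x| <= e) ->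
  {for x, continuous f}.
Proof.
move=> H; apply/cvgrPdist_le => e e0; have [d d0 dP] := H e e0.
apply/nbhs_normP; exists d => // y /=; rewrite distrC => yx.
by rewrite distrC; have := dP (y - x) yx; rewrite [x + _]addrC subrK.
Qed.

Lemma closed_form_continuous P Q x y : closed_form_at P Q x y ->
  {for x, continuous (P^~ y)} /\ {for y, continuous (Q x)}.
Proof.
move=> [a [b [c H]]].
have [d d0 dP] := H 1 ltr01.
split; apply: continuous_realP => e e0.
  have K0 : 0 < 1 + `|a| by rewrite ltr_pwDl.
  exists (Num.min d (e / (1 + `|a|))); first by rewrite lt_min d0 divr_gt0.
  move=> h; rewrite lt_min ltr_pdivlMr// => /andP[hd he].
  have [+ _] := dP h 0 hd ltac:(by rewrite normr0).
  rewrite addr0 mulr0 normr0 !addr0 mul1r => H1.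
  have := ler_normD (P (x + h) y - P x y - a * h) (a * h).
  rewrite subrK normrM; nra.
have K0 : 0 < 1 + `|c| by rewrite ltr_pwDl.
exists (Num.min d (e / (1 + `|c|))); first by rewrite lt_min d0 divr_gt0.
move=> h; rewrite lt_min ltr_pdivlMr// => /andP[hd he].
have [_] := dP 0 h ltac:(by rewrite normr0) hd.
rewrite addr0 mulr0 normr0 !add0r mul1r => H1.
have := ler_normD (Q x (y + h) - Q x y - c * h) (c * h).
rewrite subrK normrM; nra.
Qed.

Definition closed_form_on (P Q : R -> R -> R) (a c w h : R) :=
  forall x y, a <= x <= a + w -> c <= y <= c + h -> closed_form_at P Q x y.

Lemma closed_form_on_cont P Q a c w h : closed_form_on P Q a c w h ->
  (forall y, c <= y <= c + h -> cont_on (P^~ y) a (a + w)) /\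
  (forall x, a <= x <= a + w -> cont_on (Q x) c (c + h)).
Proof.
by move=> H; split=> [y yc x xa|x xa y yc];
  have [] := closed_form_continuous (H x y xa yc).
Qed.

Lemma boundary_int_split P Q a c w h : 0 <= w -> 0 <= h ->
  closed_form_on P Q a c (w + w) (h + h) ->
  boundary_int P Q a c (w + w) (h + h) =
  boundary_int P Q a c w h + boundary_int P Q (a + w) c w h
  + boundary_int P Q a (c + h) w h + boundary_int P Q (a + w) (c + h) w h.
Proof.
move=> w0 h0 /closed_form_on_cont[cP cQ]; rewrite /boundary_int !addrA.
rewrite !(@segintD _ a (a + w) (a + w + w)) ?(@segintD _ c (c + h) (c + h + h)); try lra;
  try (by rewrite -!addrA; apply: cP; lra);
  try (by rewrite -!addrA; apply: cQ; lra).
Qed.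

(** The affine part of the form contributes [- b w h] along the horizontal edges
    and [b w h] along the vertical ones, so only the remainders are left. *)
Lemma boundary_int_small P Q a c w h x y e al be ga : 0 <= w -> 0 <= h ->
  closed_form_on P Q a c w h -> 0 <= e ->
  a <= x <= a + w -> c <= y <= c + h ->
  (forall s t, `|s| <= w -> `|t| <= h ->
      `|P (x + s) (y + t) - P x y - (al * s + be * t)| <= e * (`|s| + `|t|) /\
      `|Q (x + s) (y + t) - Q x y - (be * s + ga * t)| <= e * (`|s| + `|t|)) ->
  `|boundary_int P Q a c w h| <= 2 * e * (w + h) ^+ 2.
Proof.
move=> w0 h0 /closed_form_on_cont[cP cQ] e0 xa yc H.
have est s t : `|s| <= w -> `|t| <= h ->
      `|P (x + s) (y + t) - P x y - (al * s + be * t)| <= e * (w + h) /\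
      `|Q (x + s) (y + t) - Q x y - (be * s + ga * t)| <= e * (w + h).
  move=> sw th; have [H1 H2] := H s t sw th.
  have : e * (`|s| + `|t|) <= e * (w + h) by rewrite ler_wpM2l// lerD.
  by split; lra.
rewrite /boundary_int -!segintB; try (by apply: cP; lra); try (by apply: cQ; lra).
have H1 : `|segint (fun s => P s c - P s (c + h)) a (a + w) - (- be * h) * (a + w - a)|
    <= 2 * e * (w + h) * (a + w - a).
  apply: segint_close; first lra.
    by apply: cont_onB; apply: cP; lra.
  move=> s sa.
  have [A _] := est (s - x) (c - y) ltac:(rewrite ler_norml; lra) ltac:(rewrite ler_norml; lra).
  have [B _] := est (s - x) (c + h - y) ltac:(rewrite ler_norml; lra) ltac:(rewrite ler_norml; lra).
  move: A B; rewrite ![x + _]addrC ![y + _]addrC !subrK !ler_norml; nra.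
have H2 : `|segint (fun s => Q (a + w) s - Q a s) c (c + h) - (be * w) * (c + h - c)|
    <= 2 * e * (w + h) * (c + h - c).
  apply: segint_close; first lra.
    by apply: cont_onB; apply: cQ; lra.
  move=> s sa.
  have [_ A] := est (a - x) (s - y) ltac:(rewrite ler_norml; lra) ltac:(rewrite ler_norml; lra).
  have [_ B] := est (a + w - x) (s - y) ltac:(rewrite ler_norml; lra) ltac:(rewrite ler_norml; lra).
  move: A B; rewrite ![x + _]addrC ![y + _]addrC !subrK !ler_norml; nra.
move: H1 H2; set A := segint _ _ _; set B := segint _ _ _.
rewrite !(addrC _ w) !(addrC _ h) !addrK expr2 !ler_norml; nra.
Qed.

Lemma nested_point (a b : nat -> R) :
  (forall n, a n <= a n.+1) -> (forall n, b n.+1 <= b n) -> (forall n, a n <= b n) ->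
  exists p, forall n, a n <= p <= b n.
Proof.
move=> /nondecreasing_seqP ia /nonincreasing_seqP ib ab.
have ub m n : a n <= b m.
  have /= := ia n (maxn m n) (leq_maxr _ _); have /= := ib m (maxn m n) (leq_maxl _ _).
  by have := ab (maxn m n); lra.
exists (sup (range a)) => n; apply/andP; split.
  apply: ub_le_sup; last by exists n.
  by exists (b 0%N) => _ [m _ <-].
apply: ge_sup; first by exists (a 0%N); exists 0%N.
by move=> _ [m _ <-].
Qed.

(** Goursat's argument.  If the integral were not zero, one of the four quarters
    of the rectangle would have at least a proportional share of it, and so on
    down to a point, where [boundary_int_small] makes the integral negligible
    compared with the area. *)
Lemma boundary_int_eq0 (P Q : R -> R -> R) (a c w h : R) : 0 < w -> 0 < h ->
  closed_form_on P Q a c w h -> boundary_int P Q a c w h = 0.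
Proof.
move=> w0 h0 PQ; apply/eqP/negPn/negP => J0.
(* The ratio of the square of the half-perimeter to the area is the same for all
   the rectangles produced by bisection; it converts the bound in terms of the
   perimeter into one in terms of the area. *)
pose kap := (w + h) ^+ 2 / (w * h).
pose e := `|boundary_int P Q a c w h| / (2 * (w * h)).
have e0 : 0 < e by rewrite divr_gt0 ?normr_gt0// !mulr_gt0.
pose good (s : R * R * R * R) := let: (x, y, v, k) := s in
  [/\ 0 < v, 0 < k, (v + k) ^+ 2 = kap * (v * k),
   e * (v * k) < `|boundary_int P Q x y v k| & closed_form_on P Q x y v k].
pose sub (s s' : R * R * R * R) :=
  let: (x, y, v, k) := s in let: (x', y', v', k') := s' in
  [/\ v' = v / 2, k' = k / 2, x <= x' /\ x' + v' <= x + v & y <= y' /\ y' + k' <= y + k].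
have step s : good s -> exists s', good s' /\ sub s s'.
  move: s => [[[x y] v] k] [v0 k0 vk lJ cl].
  have vE : v = v / 2 + v / 2 by lra.
  have kE : k = k / 2 + k / 2 by lra.
  have cl' x' y' : x <= x' -> x' + v / 2 <= x + v -> y <= y' -> y' + k / 2 <= y + k ->
      closed_form_on P Q x' y' (v / 2) (k / 2).
    by move=> ? ? ? ? p q ? ?; apply: cl; lra.
  have [//|Hn] := pselect (exists s', good s' /\ sub (x, y, v, k) s').
  have small x' y' : x <= x' -> x' + v / 2 <= x + v -> y <= y' -> y' + k / 2 <= y + k ->
      `|boundary_int P Q x' y' (v / 2) (k / 2)| <= e * (v * k) / 4.
    move=> ? ? ? ?; rewrite leNgt; apply/negP => lt; apply: Hn.
    exists (x', y', v / 2, k / 2); split; last by [].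
    split; [lra|lra| | |exact: cl'].
      by rewrite (_ : v / 2 + k / 2 = (v + k) / 2); [rewrite expr_div_n vk; lra|lra].
    by apply: le_lt_trans lt; lra.
  move: lJ; rewrite {2}vE {2}kE boundary_int_split; [|lra|lra|by rewrite -vE -kE].
  have A1 := small x y ltac:(lra) ltac:(lra) ltac:(lra) ltac:(lra).
  have A2 := small (x + v / 2) y ltac:(lra) ltac:(lra) ltac:(lra) ltac:(lra).
  have A3 := small x (y + k / 2) ltac:(lra) ltac:(lra) ltac:(lra) ltac:(lra).
  have A4 := small (x + v / 2) (y + k / 2) ltac:(lra) ltac:(lra) ltac:(lra) ltac:(lra).
  move: A1 A2 A3 A4; rewrite !ler_norml ltNge => ? ? ? ? /negP[].
  rewrite ler_norml; lra.
pose T := {s | good s}.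
have g0 : good (a, c, w, h).
  split=> //.
    by rewrite /kap divfK// mulf_neq0 ?gt_eqF.
  have -> : e * (w * h) = `|boundary_int P Q a c w h| / 2.
    by rewrite /e; field; rewrite !gt_eqF.
  by have : 0 < `|boundary_int P Q a c w h|; [rewrite normr_gt0 | lra].
have /choice[nxt nxtP] : forall s : T, exists s' : T, sub (sval s) (sval s').
  move=> [s gs]; by have [s' [gs' ss']] := step s gs; exists (exist _ s' gs').
pose sq n := iter n nxt (exist _ (a, c, w, h) g0).
pose X n := (sval (sq n)).1.1.1; pose Y n := (sval (sq n)).1.1.2.
pose W n := (sval (sq n)).1.2; pose H n := (sval (sq n)).2.
have gsq n : good (X n, Y n, W n, H n).
  by rewrite /X /Y /W /H; case: (sq n) => -[[[? ?] ?] ?].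
have ssq n : sub (X n, Y n, W n, H n) (X n.+1, Y n.+1, W n.+1, H n.+1).
  have := nxtP (sq n); rewrite /X /Y /W /H.
  rewrite (_ : sq n.+1 = nxt (sq n))//.
  by case: (sq n) (nxt _) => -[[[? ?] ?] ?] ? [[[[? ?] ?] ?] ?].
have [p pP] : exists p, forall n, X n <= p <= X n + W n.
  by apply: nested_point => n; have [] := ssq n; have [] := gsq n; lra.
have [q qP] : exists p, forall n, Y n <= p <= Y n + H n.
  by apply: nested_point => n; have [] := ssq n; have [] := gsq n; lra.
have [al [be [ga D]]] := PQ p q (pP 0%N) (qP 0%N).
have kap0 : 0 < kap by rewrite /kap divr_gt0 ?exprn_gt0 ?mulr_gt0// addr_gt0.
have [d d0 dP] := D (e / (4 * kap)) ltac:(by rewrite divr_gt0// mulr_gt0).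
have WE n : W n = w / 2 ^+ n.
  elim: n => [|n IH]; first by rewrite expr0 divr1.
  by have [-> _ _ _] := ssq n; rewrite IH exprS invfM; lra.
have HE n : H n = h / 2 ^+ n.
  elim: n => [|n IH]; first by rewrite expr0 divr1.
  by have [_ -> _ _] := ssq n; rewrite IH exprS invfM; lra.
have [n nP] : exists n, (w + h) / 2 ^+ n < d.
  have [n nP] : exists n : nat, (w + h) / d < n%:R.
    by exists (Num.truncn ((w + h) / d)).+1; exact: truncnS_gt.
  exists n; rewrite ltr_pdivrMr ?exprn_gt0//.
  rewrite ltr_pdivrMr// in nP; apply: lt_le_trans nP _.
  have n2 : (n%:R : R) <= 2 ^+ n by rewrite -natrX ler_nat ltnW// ltn_expl.
  by rewrite mulrC ler_wpM2l// ltW.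
have [v0 k0 vk lJ cl] := gsq n.
have : `|boundary_int P Q (X n) (Y n) (W n) (H n)|
    <= 2 * (e / (4 * kap)) * (W n + H n) ^+ 2.
  apply: (boundary_int_small (ltW v0) (ltW k0) cl _ (pP n) (qP n)).
    by rewrite ltW// divr_gt0// mulr_gt0.
  rewrite mulrDl -WE -HE in nP.
  by move=> s t sW tH; apply: dP; lra.
rewrite vk leNgt => /negP; apply; apply: le_lt_trans lJ.
rewrite (_ : 2 * (e / (4 * kap)) * (kap * (W n * H n)) = e * (W n * H n) / 2); last first.
  by field; rewrite gt_eqF.
have := mulr_gt0 e0 (mulr_gt0 v0 k0); lra.
Qed.

End Goursat.

(** * Circle means *)

Section MeanValue.
Variable R : realType.
Local Notation C := R[i].
Local Notation N := modulus.
Local Notation holo f x := (@holo_at R C^o f x).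
Local Notation cont_at f x := ({for (x : C^o), continuous (f : C^o -> C^o)}).

Lemma differentiable1P (f : C -> C) (x : C) :
  holo f x <-> exists D : C, forall e : R, 0 < e ->
    exists2 d : R, 0 < d & forall h, N h < d -> N (f (x + h) - f x - D * h) <= e * N h.
Proof.
split.
  move=> /differentiable_modulusP[L [_ H]]; exists (L 1) => e /H[d d0 dP].
  exists d => // h /dP; rewrite (_ : L h = L 1 * h)//.
  by rewrite mulrC -[RHS]/(h *: (L 1 : C^o)) -linearZ/= -[h *: 1]/(h * 1) mulr1.
move=> [D H]; apply/differentiable_modulusP.
exists ( *:%R D : {linear C^o -> C^o}); split=> [|//].
by exists (N D) => h; rewrite -modulusM.
Qed.

Lemma derive_expansion (f : R -> R) (x df : R) : is_derive x 1 f df ->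
  forall e : R, 0 < e -> exists2 d : R, 0 < d &
    forall h : R, `|h| < d -> `|f (x + h) - f x - df * h| <= e * `|h|.
Proof.
move=> [fx <-] e e0; move: fx => /cvg_ex[l fl].
have -> : 'D_1 f x = l by apply: cvg_lim.
have /cvgrPdist_le/(_ e e0) := fl.
rewrite /= near_withinE => /nbhs_normP[d /= d0 dP]; exists d => // h hd.
have [->|h0] := eqVneq h 0; first by rewrite addr0 subrr mulr0 subr0 normr0 mulr0.
have := dP h; rewrite /= sub0r normrN => /(_ hd h0).
rewrite -[h^-1 *: _]/(h^-1 * _) -[h *: 1]/(h * 1) mulr1 -ler_pdivrMr ?normr_gt0//.
rewrite -normfV -normrM distrC [h + x]addrC; congr (`|_| <= _).
by rewrite mulrBl mulfK// [_^-1 * _]mulrC.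
Qed.

(** The exponential of [s + i t].  Using [s = ln r] as radial coordinate makes
    the change of coordinates conformal, so that it preserves closedness. *)
Definition polar (s t : R) : C := Complex (expR s * cos t) (expR s * sin t).

Lemma polarD s t h k : polar (s + h) (t + k) = polar s t * polar h k.
Proof. by rewrite /polar expRD cosD sinD; simpc; congr Complex; ring. Qed.

Lemma modulus_polar s t : N (polar s t) = expR s.
Proof.
apply/eqP; rewrite -(@eqrXn2 _ 2) ?modulus_ge0 ?expR_ge0// modulus_sqr/=.
by rewrite !exprMn -mulrDr cos2Dsin2 mulr1.
Qed.

Lemma polar_expansion (e : R) : 0 < e -> exists2 d : R, 0 < d &
  forall h k : R, `|h| < d -> `|k| < d ->
    N (polar h k - 1 - Complex h k) <= e * (`|h| + `|k|).
Proof.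
move=> e0; have [a [a0 a1 ae]] : exists a : R, [/\ 0 < a, a <= 1 & a <= e / 7].
  exists (Num.min 1 (e / 7)); rewrite lt_min ltr01/= !ge_min !lexx orbT.
  by split=> //; lra.
have [d1 d10 H1] := derive_expansion (is_derive_expR (0 : R)) a0.
have [d2 d20 H2] := derive_expansion (is_derive_cos (0 : R)) a0.
have [d3 d30 H3] := derive_expansion (is_derive_sin (0 : R)) a0.
exists (Num.min a (Num.min d1 (Num.min d2 d3))); first by rewrite !lt_min a0 d10 d20 d30.
move=> h k; rewrite !lt_min => /and4P[ha hd1 _ _] /and4P[ka _ kd2 kd3].
apply: le_trans (modulus_le_ReIm _) _; rewrite !complex_ReB !complex_ImB/= subr0.
have := H1 _ hd1; have := H2 _ kd2; have := H3 _ kd3.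
rewrite !(add0r, expR0, cos0, sin0, oppr0, mul0r, subr0, addr0, mul1r).
move: ha ka.
move: (expR h) (cos k) (sin k) (cos_le1 k) (cos_geN1 k) => E c s c1 cN1 ha ka Hs Hc HE.
have h0 := normr_ge0 h; have k0 := normr_ge0 k.
have A1 : `|E * c - 1 - h| <= 2 * a * (`|h| + `|k|).
  have -> : E * c - 1 - h = (E - 1 - h) * c + (1 + h) * (c - 1) by ring.
  apply: le_trans (ler_normD _ _) _; rewrite !normrM.
  have cn : `|c| <= 1 by rewrite ler_norml; lra.
  have hn : `|1 + h| <= 2 by apply: le_trans (ler_normD _ _) _; rewrite normr1; lra.
  have B1 : `|E - 1 - h| * `|c| <= a * `|h|.
    by rewrite -[leRHS]mulr1 ler_pM.
  have B2 : `|1 + h| * `|c - 1| <= 2 * (a * `|k|) by rewrite ler_pM.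
  have : 0 <= a * `|h| by rewrite mulr_ge0// ltW.
  by rewrite mulrDr; lra.
have A2 : `|E * s - k| <= 5 * a * (`|h| + `|k|).
  have -> : E * s - k = (E - 1) * s + (s - k) by ring.
  apply: le_trans (ler_normD _ _) _; rewrite !normrM.
  have En : `|E - 1| <= 2 * a.
    have := ler_normD (E - 1 - h) h; rewrite subrK.
    have : a * `|h| <= 1 * `|h| by rewrite ler_wpM2r.
    lra.
  have sn : `|s| <= 2 * `|k|.
    have := ler_normD (s - k) k; rewrite subrK.
    have : a * `|k| <= 1 * `|k| by rewrite ler_wpM2r.
    lra.
  have : `|E - 1| * `|s| <= 2 * a * (2 * `|k|) by rewrite ler_pM.
  have : 0 <= a * `|h| by rewrite mulr_ge0// ltW.
  by rewrite mulrDr; lra.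
have A3 : 7 * a * (`|h| + `|k|) <= e * (`|h| + `|k|).
  by rewrite ler_wpM2r ?addr_ge0//; lra.
lra.
Qed.

(** The chain rule: the derivative of [f (p + polar s t)] in direction
    [h + i k] is [A * (h + i k)], and the real and imaginary parts of this
    product show the Cauchy-Riemann pattern that [closed_form_at] asks for. *)
Lemma closed_form_polar (f : C -> C) (p : C) (s t : R) :
  holo f (p + polar s t) ->
  closed_form_at (fun s t => complex.Im (f (p + polar s t)))
            (fun s t => complex.Re (f (p + polar s t))) s t.
Proof.
move=> /differentiable1P[D HD]; pose A := D * polar s t.
exists (complex.Im A), (complex.Re A), (- complex.Im A) => e e0.
have s0 : 0 < expR s by exact: expR_gt0.
have K0 : 0 < 1 + N D by rewrite ltr_pwDl// modulus_ge0.
have [d d0 dP] := HD (e / 4 / expR s) ltac:(by rewrite !divr_gt0).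
have [b [b0 bl1 b2]] : exists b : R, [/\ 0 < b, b <= 1 & b <= e / 2 / expR s / (1 + N D)].
  exists (Num.min 1 (e / 2 / expR s / (1 + N D))).
  by rewrite lt_min ltr01 !ge_min !lexx orbT !divr_gt0.
have [d' d'0 d'P] := polar_expansion b0.
exists (Num.min d' (d / 4 / expR s)); first by rewrite lt_min d'0 !divr_gt0.
move=> h k; rewrite !lt_min => /andP[hd' hd] /andP[kd' kd].
have B := d'P h k hd' kd'.
set q := `|h| + `|k| in B *.
have q0 : 0 <= q by rewrite addr_ge0.
have b1 : b * q <= q by rewrite -[leRHS]mul1r ler_wpM2r.
have B2 : N (polar h k - 1) <= 2 * q.
  have := modulusD (polar h k - 1 - Complex h k) (Complex h k); rewrite subrK.
  by have := modulus_le_ReIm (Complex h k); rewrite /= -/q; lra.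
have B3 : N (polar s t * (polar h k - 1)) <= expR s * (2 * q).
  by rewrite modulusM modulus_polar ler_wpM2l// expR_ge0.
have B4 : N (polar s t * (polar h k - 1)) < d.
  apply: le_lt_trans B3 _; rewrite -ltr_pdivlMl//.
  have : q < 2 * (d / 4 / expR s) by rewrite /q; lra.
  by rewrite [_^-1 * d]mulrC; lra.
have B5 := dP _ B4.
have F : N (f (p + polar (s + h) (t + k)) - f (p + polar s t) - A * Complex h k) <= e * q.
  have -> : f (p + polar (s + h) (t + k)) - f (p + polar s t) - A * Complex h k =
    (f (p + polar s t + polar s t * (polar h k - 1)) - f (p + polar s t)
       - D * (polar s t * (polar h k - 1))) + A * (polar h k - 1 - Complex h k).
    have -> : p + polar s t + polar s t * (polar h k - 1) = p + polar (s + h) (t + k).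
      by rewrite polarD; ring.
    by rewrite /A; ring.
  apply: le_trans (modulusD _ _) _.
  have C1 : e / 4 / expR s * N (polar s t * (polar h k - 1)) <= e / 2 * q.
    apply: (@le_trans _ _ (e / 4 / expR s * (expR s * (2 * q)))).
      by rewrite ler_wpM2l// !divr_ge0// ltW.
    by rewrite mulrA divfK ?gt_eqF//; lra.
  have C2 : N (A * (polar h k - 1 - Complex h k)) <= e / 2 * q.
    rewrite modulusM /A modulusM modulus_polar.
    apply: (@le_trans _ _ ((1 + N D) * expR s * (b * q))).
      by apply: ler_pM; rewrite ?mulr_ge0 ?modulus_ge0 ?expR_ge0// ler_wpM2r ?expR_ge0//; lra.
    rewrite mulrA ler_wpM2r// -ler_pdivlMl ?mulr_gt0// invfM.
    apply: le_trans b2 _; lra.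
  lra.
have AE : A * Complex h k = Complex (complex.Re A * h - complex.Im A * k)
                                    (complex.Im A * h + complex.Re A * k).
  case: (A) => x y; apply/eqP; rewrite eq_complex/=.
  by apply/andP; split; apply/eqP; ring.
move: F; rewrite AE => F.
split; apply: le_trans F; [apply: le_trans (Im_le_modulus _)|apply: le_trans (Re_le_modulus _)];
  rewrite ?complex_ReB ?complex_ImB/=; rewrite le_eqVlt; apply/orP; left;
  apply/eqP; congr `|_|; ring.
Qed.

(** Over the polar rectangle between two radii the vertical edges are exchanged
    by periodicity, so [boundary_int_eq0] says that both circles have the same
    mean of the real part.  Small circles have a mean close to the value at [p]
    by continuity.  Differentiability at [p] itself is not assumed: this is what
    later allows exceptional points. *)
Lemma no_strict_peak (f : C -> C) (p : C) (r d : R) : 0 < r -> 0 < d ->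
  cont_at f p ->
  (forall y, 0 < N (y - p) <= r -> holo f y) ->
  ~ (forall y, N (y - p) = r -> complex.Re (f y) <= complex.Re (f p) - d).
Proof.
move=> r0 d0 cf df H.
pose S := ln r.
have rS : expR S = r by rewrite lnK.
have /continuous_modulusP/(_ (d / 2) ltac:(lra))[e e0 eP] := cf.
pose s0 := Num.min (S - 1) (ln (e / 2)).
have s0S : s0 <= S - 1 by rewrite ge_min lexx.
have s0e : expR s0 <= e / 2.
  rewrite -[leRHS]lnK ?posrE ?divr_gt0// ler_expR.
  by rewrite ge_min lexx orbT.
pose u s t := complex.Re (f (p + polar s t)).
pose v s t := complex.Im (f (p + polar s t)).
have pi0 : 0 < 2 * pi :> R by rewrite mulr_gt0// pi_gt0.
have cl : closed_form_on v u s0 0 (S - s0) (2 * pi).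
  move=> s t sS _; apply: closed_form_polar; apply: df.
  rewrite addrC addKr modulus_polar expR_gt0/= -rS ler_expR; lra.
have Ss0 : 0 < S - s0 by lra.
have := boundary_int_eq0 Ss0 pi0 cl.
have [_ cu] := closed_form_on_cont cl.
have vp : v^~ (0 + 2 * pi) = v^~ 0.
  apply/funext => s; rewrite /v; congr (complex.Im (f (p + _))).
  by rewrite add0r mulr_natl /polar cos2pi sin2pi cos0 sin0.
rewrite /boundary_int vp subrr add0r [s0 + _]addrC subrK.
have H1 : segint (u S) 0 (0 + 2 * pi) <= (complex.Re (f p) - d) * (2 * pi).
  rewrite (_ : _ * (2 * pi) = segint (fun=> complex.Re (f p) - d) 0 (0 + 2 * pi)); last first.
    by rewrite segint_cst; [ring|lra].
  apply: segint_le => //; [by apply: cu; lra|exact: cont_on_cst|] => t _.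
  by apply: H; rewrite addrC addKr modulus_polar.
have H2 : (complex.Re (f p) - d / 2) * (2 * pi) <= segint (u s0) 0 (0 + 2 * pi).
  rewrite (_ : _ * (2 * pi) = segint (fun=> complex.Re (f p) - d / 2) 0 (0 + 2 * pi)); last first.
    by rewrite segint_cst; [ring|lra].
  apply: segint_le => //; [exact: cont_on_cst|by apply: cu; lra|] => t _.
  have := eP (p + polar s0 t); rewrite [p + _ - p]addrC addKr modulus_polar.
  move=> /(_ ltac:(lra)) F; rewrite /u.
  have := Re_le_modulus (f (p + polar s0 t) - f p).
  by rewrite complex_ReB ler_norml; lra.
move: H1 H2 (mulr_gt0 d0 pi0).
by move: (segint (u S) _ _) (segint (u s0) _ _) => A B; lra.
Qed.

End MeanValue.

(** * Rules of calculus *)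

Section Calculus.
Variable R : realType.
Local Notation C := R[i].
Local Notation N := modulus.
Variable V : normedModType C.
Local Notation holo f x := (@holo_at R V f x).
Local Notation cont_at f x := ({for x, continuous (f : V -> C^o)}).
Implicit Types (f g : V -> C) (x : V).

Lemma holo_cont f x : holo f x -> cont_at f x.
Proof. exact: differentiable_continuous. Qed.

Lemma holo_cst (c : C) x : holo (fun=> c) x.
Proof. exact: differentiable_cst. Qed.

Lemma holoD f g x : holo f x -> holo g x -> holo (fun z => f z + g z) x.
Proof. by move=> hf hg; have := differentiableD hf hg. Qed.

Lemma holoB f g x : holo f x -> holo g x -> holo (fun z => f z - g z) x.
Proof. by move=> hf hg; have := differentiableB hf hg. Qed.

Lemma holoM f g x : holo f x -> holo g x -> holo (fun z => f z * g z) x.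
Proof. by move=> hf hg; have := differentiableM hf hg. Qed.

Lemma holo_div f g x : holo f x -> holo g x -> g x != 0 -> holo (fun z => f z / g z) x.
Proof. by move=> hf hg g0; apply: holoM hf (differentiableV hg g0). Qed.

Lemma cont_cst (c : C) x : cont_at (fun=> c) x.
Proof. exact: cvg_cst. Qed.

Lemma contD f g x : cont_at f x -> cont_at g x -> cont_at (fun z => f z + g z) x.
Proof. by move=> hf hg; have := continuousD hf hg. Qed.

Lemma contB f g x : cont_at f x -> cont_at g x -> cont_at (fun z => f z - g z) x.
Proof. by move=> hf hg; have := continuousB hf hg. Qed.

Lemma contM f g x : cont_at f x -> cont_at g x -> cont_at (fun z => f z * g z) x.
Proof. by move=> hf hg; have := continuousM hf hg. Qed.

Lemma holo_comp (W : normedModType C) (g : V -> C) (h : W -> V) (x : W) :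
  differentiable h x -> holo g (h x) -> differentiable (g \o h : W -> C^o) x.
Proof. by move=> hh hg; exact: differentiable_comp hh hg. Qed.

Lemma holo_ext f g x : (exists2 d : R, 0 < d & forall y, N (y - x) < d -> f y = g y) ->
  holo f x -> holo g x.
Proof.
move=> [d d0 fg] /differentiable_modulusP[L [LK H]].
apply/differentiable_modulusP; exists L; split=> // e /H[d' d'0 d'P].
exists (Num.min d d'); first by rewrite lt_min d0.
move=> h; rewrite lt_min => /andP[hd hd'].
rewrite -!fg ?subrr ?modulus0//; last by rewrite addrC addKr.
exact: d'P.
Qed.

End Calculus.

Section Calculus1.
Variable R : realType.
Local Notation C := R[i].
Local Notation holo f x := (@holo_at R C^o f x).
Local Notation cont_at f x := ({for (x : C^o), continuous (f : C^o -> C^o)}).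

Lemma holo_id (x : C) : holo (fun z => z) x.
Proof. exact: (@ex_diff _ _ _ _ _ _ _ (is_diff_id (x : C^o))). Qed.

Lemma cont_id (x : C) : cont_at (fun z => z) x.
Proof. exact: cvg_id. Qed.

Lemma holo_comp1 (g h : C -> C) (x : C) :
  holo h x -> holo g (h x) -> holo (fun z => g (h z)) x.
Proof. by move=> hh hg; exact: differentiable_comp hh hg. Qed.

Lemma cont_comp1 (g h : C -> C) (x : C) :
  cont_at h x -> cont_at g (h x) -> cont_at (fun z => g (h z)) x.
Proof. by move=> hh hg; apply: (continuous_comp hh hg). Qed.

End Calculus1.

(** * Limits along an ultrafilter *)

Section UltraLimit.
Variable R : realType.
Local Notation C := R[i].
Local Notation N := modulus.
Variable (U : set_system nat).
Context {UU : UltraFilter U}.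

(** Convergence along the fixed ultrafilter [U]: every bounded sequence
    converges, which replaces the extraction of subsequences. *)
Definition ulim (x : nat -> C) (l : C) :=
  forall e : R, 0 < e -> U [set n | N (x n - l) < e].

Lemma ulim_real_ex (x : nat -> R) (M : R) : (forall n, `|x n| <= M) ->
  exists l, forall e : R, 0 < e -> U [set n | `|x n - l| < e].
Proof.
move=> xM; pose S := [set t : R | U [set n | t <= x n]].
have UT : U setT by exact: filterT.
have SM : S (- M).
  apply: filterS UT => n _ /=; have := xM n; rewrite ler_norml; lra.
have ubS : ubound S M.
  move=> t St; have [n /= tn] := filter_ex (F := U) St.
  have := xM n; rewrite ler_norml; lra.
have hS : has_sup S by split; [exists (- M)|exists M].
exists (sup S) => e e0.
have [t St te] := sup_adherent e0 hS.
have Ut : U [set n | x n < sup S + e].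
  have [//|] := in_ultra_setVsetC [set n | x n < sup S + e] UU.
  move=> nU; have : S (sup S + e).
    by apply: filterS nU => n /= /negP; rewrite -leNgt.
  by move=> /(ub_le_sup (ex_intro _ M ubS)); lra.
apply: filterS (filterI St Ut) => n /= [A B].
by rewrite ltr_norml; lra.
Qed.

Lemma ulim_ex (x : nat -> C) (M : R) : (forall n, N (x n) <= M) ->
  exists l, ulim x l.
Proof.
move=> xM.
have [a aP] : exists l, forall e : R, 0 < e -> U [set n | `|complex.Re (x n) - l| < e].
  by apply: (@ulim_real_ex _ M) => n; apply: le_trans (Re_le_modulus _) (xM n).
have [b bP] : exists l, forall e : R, 0 < e -> U [set n | `|complex.Im (x n) - l| < e].
  by apply: (@ulim_real_ex _ M) => n; apply: le_trans (Im_le_modulus _) (xM n).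
exists (Complex a b) => e e0.
have e2 : 0 < e / 2 by lra.
apply: filterS (filterI (aP _ e2) (bP _ e2)) => n /= [A B].
apply: le_lt_trans (modulus_le_ReIm _) _.
by rewrite complex_ReB complex_ImB/=; lra.
Qed.

Lemma ulim_le (x : nat -> C) (l a : C) (b : R) :
  ulim x l -> U [set n | N (x n - a) <= b] -> N (l - a) <= b.
Proof.
move=> xl xa; rewrite leNgt; apply/negP => ab.
have d0 : 0 < N (l - a) - b by rewrite subr_gt0.
have [n /= [A B]] := filter_ex (filterI xa (xl _ d0)).
have := modulusD (l - x n) (x n - a); rewrite addrA subrK (modulusBC l (x n)); lra.
Qed.

Lemma ulimD (x y : nat -> C) (l m : C) : ulim x l -> ulim y m -> ulim (fun n => x n + y n) (l + m).
Proof.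
move=> xl ym e e0; have e2 : 0 < e / 2 by lra.
apply: filterS (filterI (xl _ e2) (ym _ e2)) => n /= [A B].
have := modulusD (x n - l) (y n - m).
by rewrite (_ : x n - l + (y n - m) = x n + y n - (l + m)); [lra|ring].
Qed.

Lemma ulimZ (c : C) (x : nat -> C) (l : C) : ulim x l -> ulim (fun n => c * x n) (c * l).
Proof.
move=> xl e e0; have c0 := modulus_ge0 c.
have c1 : 0 < N c + 1 by lra.
have ec0 : 0 < e / (N c + 1) by rewrite divr_gt0.
apply: filterS (xl _ ec0) => n /=.
rewrite ltr_pdivlMr// -mulrBr modulusM.
have := modulus_ge0 (x n - l); nra.
Qed.

Lemma ulimB x y l m : ulim x l -> ulim y m -> ulim (fun n => x n - y n) (l - m).
Proof.
move=> xl ym; have /(ulimD xl) := ulimZ (- 1) ym.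
rewrite mulN1r (_ : (fun n => x n + -1 * y n) = (fun n => x n - y n))//.
by apply/funext => n; rewrite mulN1r.
Qed.

Lemma ulim_uniq x l m : ulim x l -> ulim x m -> l = m.
Proof.
move=> xl xm; apply/eqP; rewrite -subr_eq0 -modulus_eq0 eq_le modulus_ge0 andbT.
apply/ler_addgt0Pr => e e0; rewrite add0r.
by apply: ulim_le xl _; apply: filterS (xm e e0) => n /=; exact: ltW.
Qed.

Lemma ulim_modulus_le (x : nat -> C) (l : C) (b : R) :
  ulim x l -> (forall n, N (x n) <= b) -> N l <= b.
Proof.
move=> xl xb; rewrite -[l]subr0; apply: ulim_le xl _.
by apply: filterS (@filterT _ U _) => n _ /=; rewrite subr0.
Qed.

End UltraLimit.

Lemma ultra_nat : exists2 U : set_system nat, UltraFilter U &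
  forall k, U [set n | (k <= n)%N].
Proof.
have [U [UU sub]] := ultraFilterLemma eventually_filter.
by exists U => // k; apply: sub; exists k.
Qed.

(** * The maximum principle *)

Section MaximumPrinciple.
Variable R : realType.
Local Notation C := R[i].
Local Notation N := modulus.
Local Notation holo f x := (@holo_at R C^o f x).
Local Notation cont_at f x := ({for (x : C^o), continuous (f : C^o -> C^o)}).

(** A maximizing sequence has a limit along an ultrafilter. *)
Lemma extreme_value_disc (u : C -> R) (p : C) (r : R) : 0 < r ->
  (forall z, N (z - p) <= r -> forall e : R, 0 < e -> exists2 d : R, 0 < d &
     forall y, N (y - z) < d -> `|u y - u z| < e) ->
  exists2 z, N (z - p) <= r & forall y, N (y - p) <= r -> u y <= u z.
Proof.
move=> r0 cu.
(* The sequence is required to beat every value of [u] up to [e] eventually; this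
   form also covers a supremum not yet known to be finite. *)
have [z zP] : exists z : nat -> C, (forall n, N (z n - p) <= r) /\
    forall y (e : R), N (y - p) <= r -> 0 < e ->
      exists k, forall n, (k <= n)%N -> u y - e < u (z n).
  pose S := [set u y | y in [set y | N (y - p) <= r]].
  have S0 : S !=set0 by exists (u p); exists p => //=; rewrite subrr modulus0 ltW.
  have [ubS|nubS] := pselect (has_ubound S).
    have H n : exists y, N (y - p) <= r /\ sup S - n.+1%:R^-1 < u y.
      have n0 : 0 < n.+1%:R^-1 :> R by rewrite invr_gt0 ltr0Sn.
      by have [_ [y yr <-] ly] := sup_adherent n0 (conj S0 ubS); exists y.
    have [z zP] := choice H; exists z; split=> [n|y e yr e0]; first by have [] := zP n.
    have uS : u y <= sup S by apply: ub_le_sup => //; exists y.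
    exists (Num.truncn e^-1) => n kn; have [_] := zP n.
    suff : n.+1%:R^-1 < e by move: (n.+1%:R^-1) (u (z n)) => a b; lra.
    rewrite invf_plt ?posrE ?ltr0Sn//.
    by apply: lt_le_trans (truncnS_gt _) _; rewrite ler_nat ltnS.
  have H (n : nat) : exists y, N (y - p) <= r /\ n%:R < u y.
    apply/not_existsP => Hn; apply: nubS; exists n%:R => _ [y yr <-].
    by rewrite leNgt; apply/negP => ny; apply: (Hn y).
  have [z zP] := choice H; exists z; split=> [n|y e yr e0]; first by have [] := zP n.
  exists (Num.truncn `|u y|).+1 => n kn; have [_] := zP n.
  have : `|u y| < n%:R.
    by apply: lt_le_trans (truncnS_gt _) _; rewrite ler_nat.
  by have := ler_norm (u y); lra.
have [zr zu] := zP.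
have [U UU Unat] := ultra_nat.
have [l zl] : exists l, ulim U z l.
  apply: (ulim_ex (M := r + N p)) => n.
  by have := modulusD (z n - p) p; rewrite subrK; have := zr n; lra.
have lr : N (l - p) <= r.
  by apply: (ulim_le (U := U) zl); apply: filterS (@filterT _ U _) => n _; exact: zr.
exists l => // y yr; apply/ler_addgt0Pr => e e0.
have e2 : 0 < e / 2 by lra.
have [k kP] := zu y (e / 2) yr e2.
have [d d0 dP] := cu l lr (e / 2) e2.
have [n /= [A B]] := filter_ex (F := U) (filterI (Unat k) (zl d d0)).
have := kP n A; have := dP _ B; rewrite ltr_norml; lra.
Qed.

Lemma modulusD_sqr (a b : C) :
  N (a + b) ^+ 2 = N a ^+ 2 + 2 * complex.Re (a^* * b) + N b ^+ 2.
Proof. by rewrite !modulus_sqr; case: a b => a1 a2 [b1 b2] /=; ring. Qed.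

(** Isolated points without differentiability are allowed, since
    [no_strict_peak] needs none at its centre. *)
Lemma maximum_principle (f : C -> C) (p : C) (r M : R) : 0 < r ->
  (forall z, N (z - p) <= r -> cont_at f z) ->
  (forall z, N (z - p) < r -> exists2 d : R, 0 < d &
     forall y, 0 < N (y - z) <= d -> holo f y) ->
  (forall z, N (z - p) = r -> N (f z) <= M) ->
  forall z, N (z - p) <= r -> N (f z) <= M.
Proof.
move=> r0 cf hf fM z0 z0r; rewrite leNgt; apply/negP => Mz0.
have M0 : 0 <= M.
  apply: le_trans (modulus_ge0 (f (p + real_complex R r))) (fM _ _).
  by rewrite addrC addKr modulusR ger0_norm// ltW.
have fz0 : 0 < N (f z0) by lra.
pose c : C := (f z0)^* / real_complex R (N (f z0)).
have Nc : N c = 1.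
  by rewrite /c modulusM modulusV modulus_conj modulusR gtr0_norm// divff// gt_eqF.
have cz0 : complex.Re (c * f z0) = N (f z0).
  rewrite /c mulrAC [_^* * _]mulrC modulus_conjM -fmorphV -rmorphM/=.
  by rewrite expr2 mulfK// gt_eqF.
(* Adding [e * N (z - p) ^+ 2] makes the subharmonic comparison strict; [e] is
   small enough for the maximum to stay in the interior. *)
pose e := (N (f z0) - M) / (2 * r ^+ 2).
have r20 : 0 < r ^+ 2 by rewrite exprn_gt0.
have e0 : 0 < e by rewrite divr_gt0 ?mulr_gt0//; lra.
have er : e * r ^+ 2 = (N (f z0) - M) / 2 by rewrite /e; field; rewrite gt_eqF.
pose u z := complex.Re (c * f z) + e * N (z - p) ^+ 2.
have [] := @extreme_value_disc u p r r0.
  move=> z zr b b0; have b2 : 0 < b / 2 by lra.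
  have /continuous_modulusP/(_ _ b2)[d d0 dP] := cf z zr.
  pose K := e * (2 * r + 1).
  have K0 : 0 < K by rewrite mulr_gt0//; lra.
  exists (Num.min 1 (Num.min d (b / 2 / K))); first by rewrite !lt_min ltr01 d0 divr_gt0//; lra.
  move=> y; rewrite !lt_min => /and3P[y1 yd]; rewrite ltr_pdivlMr// => yK.
  have A : `|complex.Re (c * f y) - complex.Re (c * f z)| < b / 2.
    rewrite -complex_ReB -mulrBr; apply: le_lt_trans (Re_le_modulus _) _.
    by rewrite modulusM Nc mul1r; exact: dP.
  have B : `|e * N (y - p) ^+ 2 - e * N (z - p) ^+ 2| <= K * N (y - z).
    rewrite -mulrBr subr_sqr normrM gtr0_norm// /K -mulrA ler_pM2l//.
    rewrite normrM [leRHS]mulrC; apply: ler_pM => //.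
      have := modulusD (y - z) (z - p); rewrite addrA subrK.
      have := modulusD (z - y) (y - p); rewrite addrA subrK (modulusBC z y).
      by rewrite ler_norml; lra.
    rewrite ger0_norm ?addr_ge0 ?modulus_ge0//.
    by have := modulusD (y - z) (z - p); rewrite addrA subrK; lra.
  rewrite /u (_ : _ - _ = (complex.Re (c * f y) - complex.Re (c * f z)) +
    (e * N (y - p) ^+ 2 - e * N (z - p) ^+ 2)); last by ring.
  by apply: le_lt_trans (ler_normD _ _) _; lra.
move=> p1 p1r p1max.
have u0 : N (f z0) <= u p1.
  apply: le_trans (p1max _ z0r); rewrite /u cz0 lerDl.
  by apply: mulr_ge0; [exact: ltW|exact: sqr_ge0].
have p1lt : N (p1 - p) < r.
  rewrite lt_neqAle p1r andbT; apply/eqP => p1E.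
  have := fM _ p1E; have := Re_le_modulus (c * f p1); rewrite modulusM Nc mul1r.
  have := ler_norm (complex.Re (c * f p1)).
  by move: u0; rewrite /u p1E er; lra.
have [d d0 dP] := hf p1 p1lt.
pose rho := Num.min d (r - N (p1 - p)).
have rho0 : 0 < rho by rewrite lt_min d0; lra.
have rhod : rho <= d by rewrite ge_min lexx.
have rhor : rho <= r - N (p1 - p) by rewrite ge_min lexx orbT.
(* Up to the constant [e * rho ^+ 2] on the circle of radius [rho] about [p1], the
   quadratic perturbation is the real part of a polynomial of degree 1, which is
   absorbed into the holomorphic function [G]. *)
pose b := real_complex R (2 * e) * (p1 - p)^*.
pose G z := c * f z + b * (z - p1).
have er0 : 0 < e * rho ^+ 2 by exact: mulr_gt0 e0 (exprn_gt0 2 rho0).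
apply: (no_strict_peak (f := G) rho0 er0).
- apply: contD; first by apply: contM; [exact: cont_cst|exact: (cf p1 p1r)].
  by apply: contM; [exact: cont_cst|apply: contB; [exact: cont_id|exact: cont_cst]].
- move=> y /andP[y0 yr]; apply: holoD.
    by apply: holoM; [exact: holo_cst|apply: dP; rewrite y0/=; lra].
  by apply: holoM; [exact: holo_cst|apply: holoB; [exact: holo_id|exact: holo_cst]].
- move=> y yr.
  have yp : N (y - p) <= r.
    by have := modulusD (y - p1) (p1 - p); rewrite addrA subrK; lra.
  have := p1max y yp; rewrite /u /G !complex_ReD subrr mulr0 /=.
  have -> : y - p = (p1 - p) + (y - p1) by ring.
  rewrite (modulusD_sqr (p1 - p)) yr.
  have -> : complex.Re (b * (y - p1)) = 2 * e * complex.Re ((p1 - p)^* * (y - p1)).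
    rewrite /b -mulrA; case: (_ * (y - p1)) => x1 x2 /=; ring.
  nra.
Qed.

End MaximumPrinciple.

(** * Schwarz's lemma on a disc *)

Section Schwarz.
Variable R : realType.
Local Notation C := R[i].
Local Notation N := modulus.
Local Notation holo f x := (@holo_at R C^o f x).
Local Notation cont_at f x := ({for (x : C^o), continuous (f : C^o -> C^o)}).

Lemma ler_mul_limit (a b s r : R) : s < r ->
  (forall t, s < t < r -> a * t <= b) -> a * r <= b.
Proof.
move=> sr H; rewrite leNgt; apply/negP => br.
have [a0|a0] := leP a 0.
  have := H ((s + r) / 2) ltac:(lra); have : a * r <= a * ((s + r) / 2).
    by rewrite ler_wnM2l//; lra.
  lra.
pose m := Num.max s (b / a).
have mr : m < r by rewrite gt_max sr ltr_pdivrMr// mulrC.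
have sm : s <= m by rewrite le_max lexx.
have bm : b / a <= m by rewrite le_max lexx orbT.
have := H ((m + r) / 2) ltac:(lra).
apply/negP; rewrite -ltNge mulrC -ltr_pdivrMr//; lra.
Qed.

Lemma punctured_neq (a z : C) : exists2 d : R, 0 < d &
  forall y, 0 < N (y - z) <= d -> y != a.
Proof.
have [->|az] := eqVneq a z.
  by exists 1 => // y /andP[y0 _]; rewrite -subr_eq0 -modulus_gt0.
exists (N (a - z) / 2); first by rewrite divr_gt0// modulus_gt0 subr_eq0.
move=> y /andP[_ yz]; apply/eqP => ya; move: yz; rewrite ya.
have : 0 < N (a - z) by rewrite modulus_gt0 subr_eq0.
lra.
Qed.

(** The filling-in value [D] is free, so that the quotient also makes sense
    before the derivative is known. *)
Definition diff_quot (f : C -> C) (p D y : C) : C :=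
  if y == p then D else (f y - f p) / (y - p).

Lemma diff_quot_holo f p D y : holo f y -> y != p -> holo (diff_quot f p D) y.
Proof.
move=> hf yp; have y0 : 0 < N (y - p) by rewrite modulus_gt0 subr_eq0.
apply: (@holo_ext R C^o (fun z => (f z - f p) / (z - p))).
  exists (N (y - p)) => // t ty; rewrite /diff_quot; case: eqP => // tp.
  by move: ty; rewrite tp modulusBC ltxx.
apply: holo_div; last by rewrite subr_eq0.
  by apply: holoB; [exact: hf|exact: holo_cst].
by apply: holoB; [exact: holo_id|exact: holo_cst].
Qed.

Lemma diff_quot_cont f p : holo f p -> exists D, cont_at (diff_quot f p D) p.
Proof.
move=> /differentiable1P[D HD]; exists D; apply/continuous_modulusP => e e0.
have e2 : 0 < e / 2 by lra.
have [d d0 dP] := HD _ e2; exists d => // t td.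
rewrite /diff_quot eqxx; case: eqP => [_|/eqP tp]; first by rewrite subrr modulus0.
have tp0 : 0 < N (t - p) by rewrite modulus_gt0 subr_eq0.
have := dP _ td; rewrite [p + _]addrC subrK => H.
have -> : (f t - f p) / (t - p) - D = (f t - f p - D * (t - p)) / (t - p).
  by field; rewrite subr_eq0.
rewrite modulusM modulusV ltr_pdivrMr//; apply: le_lt_trans H _.
by rewrite ltr_pM2r//; lra.
Qed.

(** The maximum principle for the difference quotient on circles of radius
    [t < r], followed by [t] tending to [r].  The quotient is only known to be
    continuous at [p], which is enough. *)
Lemma schwarz_center (f : C -> C) (p : C) (r M : R) : 0 < r ->
  (forall z, N (z - p) < r -> holo f z) ->
  (forall z, N (z - p) < r -> N (f z - f p) <= M) ->
  forall z, N (z - p) < r -> N (f z - f p) * r <= M * N (z - p).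
Proof.
move=> r0 hf fM z zr.
have pr : N (p - p) < r by rewrite subrr modulus0.
have [D cD] := diff_quot_cont (hf p pr).
pose g := diff_quot f p D.
have hg y : N (y - p) < r -> y != p -> holo g y.
  by move=> yr yp; exact: diff_quot_holo (hf y yr) yp.
have cg y : N (y - p) < r -> cont_at g y.
  by move=> yr; have [->//|yp] := eqVneq y p; apply: holo_cont; exact: hg.
apply: (ler_mul_limit zr) => t /andP[zt tr].
have t0 : 0 < t by apply: le_lt_trans zt; exact: modulus_ge0.
have := @maximum_principle R g p t (M / t) t0 _ _ _ z (ltW zt).
have [->|zp] := eqVneq z p; first by rewrite !subrr !modulus0 mul0r mulr0.
have zp0 : 0 < N (z - p) by rewrite modulus_gt0 subr_eq0.
rewrite /g /diff_quot (negbTE zp) modulusM modulusV => H.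
suff : N (f z - f p) / N (z - p) <= M / t.
  by rewrite ler_pdivrMr// mulrAC ler_pdivlMr.
apply: H.
- by move=> y yt; apply: cg; apply: le_lt_trans tr.
- move=> y yt; have [d d0 dP] := punctured_neq p y.
  exists (Num.min d ((r - N (y - p)) / 2)); first by rewrite lt_min d0; lra.
  move=> x; rewrite le_min => /and3P[x0 xd xr]; apply: hg; last by apply: dP; rewrite x0.
  by have := modulusD (x - y) (y - p); rewrite addrA subrK; lra.
- move=> y yt; rewrite /g /diff_quot; case: eqP => [yp|_].
    by move: yt; rewrite yp subrr modulus0 => t00; rewrite -t00 ltxx in t0.
  rewrite modulusM modulusV yt ler_pM2r ?invr_gt0//; apply: fM.
  by rewrite yt.
Qed.
End Schwarz.

(** * Taylor estimates of order one and two *)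

Section Estimates.
Variable R : realType.
Local Notation C := R[i].
Local Notation N := modulus.
Local Notation holo f x := (@holo_at R C^o f x).
Local Notation cont_at f x := ({for (x : C^o), continuous (f : C^o -> C^o)}).

Lemma lipschitz_center (f : C -> C) (p : C) (r M : R) : 0 < r ->
  (forall z, N (z - p) < r -> holo f z) ->
  (forall z, N (z - p) < r -> N (f z) <= M) ->
  forall z, N (z - p) < r -> N (f z - f p) * r <= 2 * M * N (z - p).
Proof.
move=> r0 hf fM; apply: schwarz_center => // z zr.
have pr : N (p - p) < r by rewrite subrr modulus0.
have := modulusB (f z) (f p); have := fM z zr; have := fM p pr; lra.
Qed.

(** The second difference is an increment of the first difference
    [f (z + k) - f z], which is itself holomorphic and, by
    [lipschitz_center], of size [N k]. *)
Lemma second_difference (f : C -> C) (p k : C) (r M : R) : 0 < r ->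
  (forall z, N (z - p) < r -> holo f z) ->
  (forall z, N (z - p) < r -> N (f z) <= M) ->
  N k < r / 8 ->
  N (f (p + k + k) - f p - 2 * (f (p + k) - f p)) * r ^+ 2 <= 32 * M * N k ^+ 2.
Proof.
move=> r0 hf fM kr; pose q z := f (z + k) - f z.
have k0 := modulus_ge0 k.
have zk z : N (z - p) < r / 2 -> N (z + k - p) < r.
  by move=> zr; have := modulusD (z - p) k; rewrite addrAC; lra.
have qM z : N (z - p) < r / 2 -> N (q z) <= 8 * M * N k / r.
  move=> zr; rewrite ler_pdivlMr//.
  have := @lipschitz_center f z (r / 4) M ltac:(lra) _ _ (z + k).
  rewrite [z + k]addrC addrK -/(q z) => H.
  suff : N (q z) * (r / 4) <= 2 * M * N k by lra.
  rewrite /q [z + k]addrC; apply: H; last lra.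
    move=> y yz; apply: hf.
    by have := modulusD (y - z) (z - p); rewrite addrA subrK; lra.
  move=> y yz; apply: fM.
  by have := modulusD (y - z) (z - p); rewrite addrA subrK; lra.
have hq z : N (z - p) < r / 2 -> holo q z.
  move=> zr; apply: holoB; last by apply: hf; lra.
  apply: (@holo_comp1 _ f (fun z => z + k)); last by apply/hf/zk.
  by apply: holoD; [exact: holo_id|exact: holo_cst].
have r2 : 0 < r / 2 by lra.
have kr2 : N k < r / 2 by lra.
have := lipschitz_center r2 hq qM (z := p + k).
rewrite (_ : p + k - p = k); last by rewrite addrC addKr.
move=> /(_ kr2).
have -> : q (p + k) - q p = f (p + k + k) - f p - 2 * (f (p + k) - f p).
  by rewrite /q; ring.
set X := N _ => H.
have : X * (r / 2) * r <= 2 * (8 * M * N k / r) * N k * r by rewrite ler_wpM2r// ltW.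
rewrite (_ : 2 * (8 * M * N k / r) * N k * r = 16 * M * N k ^+ 2); first by lra.
by field; rewrite gt_eqF.
Qed.

(** Halving [h] repeatedly writes the remainder as a geometric series of second
    differences; the increments rescaled by powers of 2 tend to [D * h].  The
    bound depends on [f] only through [M], which is what makes it useful for
    families of functions. *)
Lemma quadratic_estimate (f : C -> C) (p D h : C) (r M : R) : 0 < r ->
  (forall z, N (z - p) < r -> holo f z) ->
  (forall z, N (z - p) < r -> N (f z) <= M) ->
  (forall e : R, 0 < e -> exists2 d : R, 0 < d &
    forall h, N h < d -> N (f (p + h) - f p - D * h) <= e * N h) ->
  N h < r / 4 ->
  N (f (p + h) - f p - D * h) * r ^+ 2 <= 16 * M * N h ^+ 2.
Proof.
move=> r0 hf fM HD hr; have h0 := modulus_ge0 h.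
have r20 : 0 < r ^+ 2 by rewrite exprn_gt0.
have M0 : 0 <= M.
  by apply: le_trans (fM p _); rewrite ?modulus_ge0// subrr modulus0.
pose a n : R := 2^-1 ^+ n; pose c n : C := real_complex R (a n).
have a0 n : 0 < a n by rewrite exprn_gt0// invr_gt0.
have a1 n : a n <= 1 by rewrite exprn_ile1// invf_le1// ler1n.
have aS n : a n = 2 * a n.+1 by rewrite /a exprS mulrA divff// mul1r.
have cS n : c n = 2 * c n.+1 by rewrite /c aS rmorphM/= rmorph_nat.
have Nc n : N (c n) = a n by rewrite modulusR gtr0_norm.
pose dl n := f (p + c n * h) - f p.
have T n : N (dl 0%N - dl n / c n) * r ^+ 2 <= 16 * M * N h ^+ 2 * (1 - a n).
  elim: n => [|n IH].
    by rewrite /c /a !expr0 divr1 !subrr modulus0 mul0r mulr0.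
  have B : N (dl n - 2 * dl n.+1) * r ^+ 2 <= 32 * M * (a n.+1 * N h) ^+ 2.
    have := @second_difference f p (c n.+1 * h) r M r0 hf fM.
    rewrite modulusM Nc -(addrA p) -mulrDl.
    rewrite (_ : c n.+1 + c n.+1 = c n); last by rewrite (cS n); ring.
    apply; apply: le_lt_trans (_ : 2^-1 * N h < _); last by lra.
    by apply: ler_wpM2r => //; have := a1 n; rewrite aS; lra.
  have -> : dl 0%N - dl n.+1 / c n.+1 = (dl 0%N - dl n / c n) + (dl n - 2 * dl n.+1) / c n.
    rewrite (cS n); field.
    by rewrite -modulus_eq0 Nc gt_eqF.
  have B' : N ((dl n - 2 * dl n.+1) / c n) * r ^+ 2 <= 16 * M * N h ^+ 2 * a n.+1.
    rewrite modulusM modulusV Nc mulrAC ler_pdivrMr//.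
    by apply: le_trans B _; rewrite (aS n) exprMn; lra.
  apply: le_trans (_ : (N (dl 0%N - dl n / c n) + N ((dl n - 2 * dl n.+1) / c n)) * r ^+ 2 <= _).
    by rewrite ler_wpM2r ?modulusD// ltW.
  by rewrite mulrDl; move: IH B'; rewrite (aS n); lra.
apply/ler_addgt0Pr => e e0.
pose e' := e / (r ^+ 2 * (N h + 1)).
have e'0 : 0 < e' by rewrite divr_gt0// mulr_gt0//; lra.
have [d d0 dP] := HD e' e'0.
have [n nP] : exists n, a n * (N h + 1) < d.
  exists (Num.truncn ((N h + 1) / d)).+1; set n := _.+1.
  have n2 : (n%:R : R) <= 2 ^+ n by rewrite -natrX ler_nat ltnW// ltn_expl.
  have : (N h + 1) / d < n%:R by exact: truncnS_gt.
  rewrite ltr_pdivrMr// => H.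
  rewrite /a exprVn mulrC ltr_pdivrMr ?exprn_gt0//.
  by apply: lt_le_trans H _; rewrite mulrC ler_wpM2l// ltW.
have cnh : N (c n * h) < d by rewrite modulusM Nc; have := a0 n; nra.
have := dP _ cnh; rewrite -/(dl n) modulusM Nc => H.
have H2 : N (dl n / c n - D * h) <= e' * N h.
  have -> : dl n / c n - D * h = (dl n - D * (c n * h)) / c n.
    by field; rewrite -modulus_eq0 Nc gt_eqF.
  by rewrite modulusM modulusV Nc ler_pdivrMr//; lra.
have -> : f (p + h) - f p - D * h = (dl 0%N - dl n / c n) + (dl n / c n - D * h).
  by rewrite /dl /c /a expr0 mul1r; ring.
apply: le_trans (_ : (N (dl 0%N - dl n / c n) + N (dl n / c n - D * h)) * r ^+ 2 <= _).
  by rewrite ler_wpM2r ?modulusD// ltW.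
rewrite mulrDl lerD//.
  apply: le_trans (T n) _; rewrite ler_piMr//; last by have := a0 n; lra.
  by rewrite !mulr_ge0// sqr_ge0.
apply: le_trans (_ : e' * N h * r ^+ 2 <= _); first by rewrite ler_wpM2r// ltW.
rewrite /e' -[leRHS]mulr1 (_ : e / _ * _ * _ = e * (N h / (N h + 1))); last first.
  by field; rewrite !gt_eqF//; lra.
by apply: ler_wpM2l; [exact: ltW|rewrite ler_pdivrMr; lra].
Qed.

End Estimates.

(** * Removable singularities *)

Section Removable.
Variable R : realType.
Local Notation C := R[i].
Local Notation N := modulus.
Local Notation holo f x := (@holo_at R C^o f x).
Local Notation cont_at f x := ({for (x : C^o), continuous (f : C^o -> C^o)}).

(** On a circle about [p] the difference quotients with steps [h] and [k] differ
    by at most a multiple of [N h + N k], by [quadratic_estimate].  The maximum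
    principle, with [p], [p - h] and [p - k] as exceptional points, carries the
    bound to [p], where it says that the quotients have a limit. *)
Lemma removable_singularity (f : C -> C) (p : C) (r : R) : 0 < r ->
  cont_at f p -> (forall z, 0 < N (z - p) < r -> holo f z) -> holo f p.
Proof.
move=> r0 cfp hf0.
have [r1 [r10 r1r fM]] : exists r1 : R, [/\ 0 < r1, r1 <= r &
    forall z, N (z - p) < r1 -> N (f z) <= N (f p) + 1].
  have /continuous_modulusP/(_ 1 ltr01)[d d0 dP] := cfp.
  exists (Num.min d r); rewrite lt_min d0 r0 ge_min lexx orbT; split=> // z.
  rewrite lt_min => /andP[/dP zd _].
  by have := modulusBr (f z) (f p); lra.
move: (N (f p) + 1) fM => M fM.
have hf z : 0 < N (z - p) < r1 -> holo f z.
  by move=> /andP[z0 zr]; apply: hf0; rewrite z0 (lt_le_trans zr).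
have cf z : N (z - p) < r1 -> cont_at f z.
  move=> zr; have [->//|zp] := eqVneq z p.
  by apply: holo_cont; apply: hf; rewrite modulus_gt0 subr_eq0 zp.
have M0 : 0 <= M.
  by apply: le_trans (fM p _); rewrite ?modulus_ge0// subrr modulus0.
pose rho := r1 / 2.
have rho0 : 0 < rho by rewrite divr_gt0.
have r1E : r1 = rho + rho by rewrite /rho; lra.
pose q h z := (f (z + h) - f z) / h.
pose K := 16 * M / rho ^+ 2.
have K0 : 0 <= K by rewrite !mulr_ge0// ltW// invr_gt0 exprn_gt0.
have circ z : N (z - p) = rho -> exists D, forall h, h != 0 -> N h < rho / 4 ->
    N (q h z - D) <= K * N h.
  move=> zrho.
  have disc_z y : N (y - z) < rho -> 0 < N (y - p) < r1.
    move=> yz; have := modulusD (y - z) (z - p); rewrite addrA subrK.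
    have := modulusD (z - y) (y - p); rewrite addrA subrK (modulusBC z y); lra.
  have /differentiable1P[D HD] : holo f z by apply/hf/disc_z; rewrite subrr modulus0.
  exists D => h h0 hr.
  have Nh : 0 < N h by rewrite modulus_gt0.
  have hfz y : N (y - z) < rho -> holo f y by move=> /disc_z/hf.
  have fMz y : N (y - z) < rho -> N (f y) <= M by move=> /disc_z/andP[_ /fM].
  have := quadratic_estimate rho0 hfz fMz HD hr.
  rewrite (_ : f (z + h) - f z - D * h = (q h z - D) * h); last by rewrite /q; field.
  rewrite modulusM -ler_pdivlMr ?exprn_gt0// => H.
  by rewrite -(ler_pM2r Nh); apply: le_trans H _; rewrite /K; lra.
have main h k : h != 0 -> k != 0 -> N h < rho / 4 -> N k < rho / 4 ->
    N (q h p - q k p) <= K * (N h + N k).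
  move=> h0 k0 hr kr.
  have zh z l : N (z - p) <= rho -> N l < rho / 4 -> N (z + l - p) < r1.
    by move=> zr lr; have := modulusD (z - p) l; rewrite addrAC; lra.
  have cs z l : N (z - p) <= rho -> N l < rho / 4 -> cont_at (q l) z.
    move=> zr lr; apply: contM; last exact: cont_cst.
    apply: contB; last by apply: cf; lra.
    apply: (@cont_comp1 _ f (fun y => y + l)); last by apply/cf/zh.
    by apply: contD; [exact: cont_id|exact: cont_cst].
  apply: (@maximum_principle R (fun z => q h z - q k z) p rho (K * (N h + N k)) rho0).
  - by move=> z zr; apply: contB; apply: cs.
  - move=> z zr.
    have [d1 d10 d1P] := punctured_neq p z.
    have [d2 d20 d2P] := punctured_neq (p - h) z.
    have [d3 d30 d3P] := punctured_neq (p - k) z.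
    exists (Num.min ((rho - N (z - p)) / 2) (Num.min d1 (Num.min d2 d3))).
      by rewrite !lt_min d10 d20 d30 !andbT; lra.
    move=> y; rewrite !le_min => /and5P[y0 ye yd1 yd2 yd3].
    have yp : N (y - p) <= rho.
      by have := modulusD (y - z) (z - p); rewrite addrA subrK; lra.
    have hq l : N l < rho / 4 -> y != p - l -> holo (q l) y.
      move=> lr yl; apply: holoM; last exact: holo_cst.
      apply: holoB; last first.
        by apply: hf; rewrite modulus_gt0 subr_eq0 d1P ?y0//=; lra.
      apply: (@holo_comp1 _ f (fun y => y + l)).
        by apply: holoD; [exact: holo_id|exact: holo_cst].
      apply: hf; rewrite zh// andbT modulus_gt0.
      by rewrite (_ : y + l - p = y - (p - l)); [rewrite subr_eq0|ring].
    apply: holoB; first by apply: (hq h hr); apply: d2P; rewrite y0.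
    by apply: (hq k kr); apply: d3P; rewrite y0.
  - move=> z zr; have [D HD] := circ z zr.
    have := modulusB (q h z - D) (q k z - D).
    rewrite (_ : q h z - D - (q k z - D) = q h z - q k z); last by ring.
    by have := HD h h0 hr; have := HD k k0 kr; lra.
  - by rewrite subrr modulus0 ltW.
(* Any sequence of steps tending to 0 will do to produce the derivative. *)
pose s n : C := real_complex R (rho / 8 / n.+1%:R).
have Ns n : N (s n) = rho / 8 / n.+1%:R.
  by rewrite modulusR ger0_norm// !divr_ge0// ltW.
have sr n : N (s n) < rho / 4.
  rewrite Ns ltr_pdivrMr ?ltr0Sn//.
  have : (1 : R) <= n.+1%:R by rewrite ler1n.
  nra.
have s0 n : s n != 0 by rewrite -modulus_gt0 Ns !divr_gt0.
have [U UU Unat] := ultra_nat.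
have [D DP] : exists D, ulim U (fun n => q (s n) p) D.
  apply: (ulim_ex (M := N (q (s 0%N) p) + K * (rho / 2))) => n.
  have := main _ _ (s0 n) (s0 0%N) (sr n) (sr 0%N).
  have := modulusBr (q (s n) p) (q (s 0%N) p).
  have : K * (N (s n) + N (s 0%N)) <= K * (rho / 2).
    by apply: ler_wpM2l => //; have := sr n; have := sr 0%N; lra.
  lra.
have qD h : h != 0 -> N h < rho / 4 -> N (q h p - D) <= K * N h.
  move=> h0 hr; rewrite modulusBC; apply/ler_addgt0Pr => e e0.
  apply: (ulim_le DP); apply: filterS (Unat (Num.truncn (K * rho / e))) => n /= nP.
  apply: le_trans (main _ _ (s0 n) h0 (sr n) hr) _.
  rewrite mulrDr addrC lerD2l Ns.
  have : K * rho / e < n.+1%:R.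
    by apply: lt_le_trans (truncnS_gt _) _; rewrite ler_nat ltnS.
  rewrite ltr_pdivrMr// => H; rewrite mulrA ler_pdivrMr ?ltr0Sn//.
  have : 0 <= K * rho by rewrite mulr_ge0// ltW.
  by rewrite [e * _]mulrC; lra.
apply/differentiable1P; exists D => e e0.
exists (Num.min (rho / 4) (e / (K + 1))).
  by rewrite lt_min !divr_gt0//; lra.
move=> h; rewrite lt_min => /andP[hr]; rewrite ltr_pdivlMr; last lra.
have [->|h0] := eqVneq h 0; first by rewrite addr0 subrr mulr0 subr0 modulus0 mulr0.
move=> he; rewrite (_ : f (p + h) - f p - D * h = (q h p - D) * h); last by rewrite /q; field.
rewrite modulusM ler_wpM2r ?modulus_ge0//; apply: le_trans (qD h h0 hr) _.
by have := modulus_ge0 h; nra.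
Qed.

End Removable.

(** * Blaschke factors and the Schwarz-Pick lemma *)

Section MobiusFactor.
Variable R : realType.
Local Notation C := R[i].
Local Notation N := modulus.
Local Notation holo f x := (@holo_at R C^o f x).
Local Notation cont_at f x := ({for (x : C^o), continuous (f : C^o -> C^o)}).

(** The disc automorphism that sends [a] to 0. *)
Definition bfactor (a z : C) : C := (z - a) / (1 - a^* * z).

Lemma conjE (x y : R) : (Complex x y : C)^* = Complex x (- y).
Proof. by []. Qed.

(** The identity behind every estimate on [bfactor]: it fixes the sign of
    [1 - N (bfactor a z)] on either side of the unit circle. *)
Lemma bfactor_sqr (a z : C) :
  N (1 - a^* * z) ^+ 2 - N (z - a) ^+ 2 = (1 - N a ^+ 2) * (1 - N z ^+ 2).
Proof. by rewrite !modulus_sqr; case: a z => a1 a2 [z1 z2]; rewrite conjE/=; ring. Qed.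

Lemma bfactor_den (a z : C) : N a < 1 -> N z <= 1 -> 1 - a^* * z != 0.
Proof.
move=> a1 z1; rewrite subr_eq0 eq_sym; apply/eqP => H.
have := modulusM a^* z; rewrite H modulus1 modulus_conj.
have := modulus_ge0 a; have := modulus_ge0 z; nra.
Qed.

Lemma sqr_lt1 (x : R) : 0 <= x -> (x ^+ 2 < 1) = (x < 1).
Proof. by move=> x0; rewrite -[X in _ < X](expr1n _ 2) ltr_pXn2r ?nnegrE. Qed.

Lemma sqr_le1 (x : R) : 0 <= x -> (x ^+ 2 <= 1) = (x <= 1).
Proof. by move=> x0; rewrite -[X in _ <= X](expr1n _ 2) ler_pXn2r ?nnegrE. Qed.

Lemma bfactor_lt1 (a z : C) : N a < 1 -> N z < 1 -> N (bfactor a z) < 1.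
Proof.
move=> a1 z1; have d0 := bfactor_den a1 (ltW z1).
rewrite /bfactor modulusM modulusV ltr_pdivrMr ?modulus_gt0// mul1r.
rewrite -(@ltr_pXn2r _ 2) ?nnegrE ?modulus_ge0// -subr_gt0 bfactor_sqr.
by rewrite mulr_gt0// subr_gt0 sqr_lt1// modulus_ge0.
Qed.

Lemma bfactor_le1 (a z : C) : N a < 1 -> N z <= 1 -> N (bfactor a z) <= 1.
Proof.
move=> a1 z1; have d0 := bfactor_den a1 z1.
rewrite /bfactor modulusM modulusV ler_pdivrMr ?modulus_gt0// mul1r.
rewrite -(@ler_pXn2r _ 2) ?nnegrE ?modulus_ge0// -subr_ge0 bfactor_sqr.
by rewrite mulr_ge0// subr_ge0 sqr_le1 ?modulus_ge0// ltW.
Qed.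

Lemma bfactorK (a z : C) : N a < 1 -> N z <= 1 -> bfactor (- a) (bfactor a z) = z.
Proof.
move=> a1 z1; have d0 := bfactor_den a1 z1.
have e0 : 1 - a^* * a != 0 by apply: bfactor_den => //; exact: ltW.
rewrite /bfactor rmorphN/= opprK.
set d := 1 - a^* * z in d0 *.
have -> : (z - a) / d + a = z * (1 - a^* * a) / d by rewrite /d; field.
have -> : 1 - - a^* * ((z - a) / d) = (1 - a^* * a) / d by rewrite /d; field.
by field; rewrite d0.
Qed.

Lemma bfactor_self (a : C) : bfactor a a = 0.
Proof. by rewrite /bfactor subrr mul0r. Qed.

Lemma bfactor_eq0 (a z : C) : N a < 1 -> N z < 1 -> (bfactor a z == 0) = (z == a).
Proof.
move=> a1 z1; rewrite /bfactor mulf_eq0 invr_eq0 subr_eq0.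
by rewrite (negbTE (bfactor_den a1 (ltW z1))) orbF.
Qed.

Lemma holo_bfactor (a z : C) : N a < 1 -> N z <= 1 -> holo (bfactor a) z.
Proof.
move=> a1 z1; apply: holo_div; last exact: bfactor_den.
  by apply: holoB; [exact: holo_id|exact: holo_cst].
apply: holoB; first exact: holo_cst.
by apply: holoM; [exact: holo_cst|exact: holo_id].
Qed.

Definition holo_disc (f : C -> C) := forall z, N z < 1 -> holo f z.

Definition bounded_disc (f : C -> C) (M : R) := forall z, N z < 1 -> N (f z) <= M.

Lemma schwarz_zero (f : C -> C) (a : C) (M : R) : N a < 1 ->
  holo_disc f -> bounded_disc f M -> f a = 0 ->
  forall z, N z < 1 -> N (f z) <= M * N (bfactor a z).
Proof.
move=> a1 hf fM fa z z1.
have Na1 : N (- a) < 1 by rewrite modulusN.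
pose F y := f (bfactor (- a) y).
have F0 : F 0 = 0.
  by rewrite /F /bfactor sub0r opprK mulr0 subr0 divr1.
have := @schwarz_center R F 0 1 M ltr01 _ _ (bfactor a z).
rewrite F0 !subr0 mulr1 /F bfactorK//; last exact: ltW.
apply; last exact: bfactor_lt1.
  move=> y; rewrite subr0 => y1; apply: (@holo_comp1 _ f (bfactor (- a))).
    exact: holo_bfactor Na1 (ltW y1).
  by apply: hf; exact: bfactor_lt1.
by move=> y; rewrite !subr0 => y1; apply: fM; exact: bfactor_lt1.
Qed.

(** The division step of Schur's algorithm.  The quotient extends across [a] by
    [removable_singularity], and its bound there follows by continuity. *)
Lemma schwarz_factor (f : C -> C) (a : C) (M : R) : N a < 1 ->
  holo_disc f -> bounded_disc f M -> f a = 0 ->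
  exists g, [/\ holo_disc g, bounded_disc g M &
    forall z, N z < 1 -> f z = bfactor a z * g z].
Proof.
move=> a1 hf fM fa.
have [D cD] := diff_quot_cont (hf a a1).
pose k := diff_quot f a D.
have hk z : N z < 1 -> holo k z.
  move=> z1; have [->|za] := eqVneq z a; last exact: diff_quot_holo (hf z z1) za.
  have a1' : 0 < 1 - N a by lra.
  apply: (removable_singularity a1' cD).
  move=> y /andP[y0 ya]; apply: diff_quot_holo; last by rewrite -subr_eq0 -modulus_gt0.
  by apply: hf; have := modulusD (y - a) a; rewrite subrK; lra.
pose g z := k z * (1 - a^* * z).
have hg : holo_disc g.
  move=> z z1; apply: holoM; first exact: hk.
  apply: holoB; first exact: holo_cst.
  by apply: holoM; [exact: holo_cst|exact: holo_id].
have fE z : N z < 1 -> f z = bfactor a z * g z.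
  move=> z1; have d0 := bfactor_den a1 (ltW z1).
  rewrite /g /k /diff_quot fa; case: eqP => [->|/eqP za].
    by rewrite fa bfactor_self mul0r.
  by rewrite /bfactor subr0; field; rewrite subr_eq0 za d0.
have gM0 z : N z < 1 -> z != a -> N (g z) <= M.
  move=> z1 za; have := schwarz_zero a1 hf fM fa z1.
  rewrite (fE _ z1) modulusM mulrC ler_pM2r//.
  by rewrite modulus_gt0 bfactor_eq0.
exists g; split=> // z z1; have [->|za] := eqVneq z a; last exact: gM0.
rewrite leNgt; apply/negP => ga.
have e0 : 0 < N (g a) - M by lra.
have /continuous_modulusP/(_ _ e0)[d d0 dP] := holo_cont (hg a a1).
pose t := Num.min (d / 2) ((1 - N a) / 2).
have t0 : 0 < t by rewrite lt_min !divr_gt0//; lra.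
have td : t <= d / 2 by rewrite ge_min lexx.
have ta : t <= (1 - N a) / 2 by rewrite ge_min lexx orbT.
pose y := a + real_complex R t.
have ya : y - a = real_complex R t by rewrite /y addrC addKr.
have Nya : N (y - a) = t by rewrite ya modulusR gtr0_norm.
have y1 : N y < 1 by have := modulusD (y - a) a; rewrite subrK; lra.
have := gM0 y y1; rewrite -subr_eq0 -modulus_gt0 Nya => /(_ t0).
have := dP y ltac:(rewrite Nya; lra).
by have := modulusBr (g a) (g y); rewrite (modulusBC (g a)); lra.
Qed.

Lemma holo_bfactor_comp (f : C -> C) (a z : C) : N a < 1 -> holo f z -> N (f z) <= 1 ->
  holo (fun y => bfactor a (f y)) z.
Proof.
by move=> a1 hf fz; exact: (holo_comp1 hf (holo_bfactor a1 fz)).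
Qed.

Lemma schwarz_pick (f : C -> C) (a : C) : N a < 1 ->
  holo_disc f -> bounded_disc f 1 -> N (f a) < 1 ->
  forall z, N z < 1 -> N (f z - f a) <= N (bfactor a z) * N (1 - (f a)^* * f z).
Proof.
move=> a1 hf f1 fa z z1.
have : N (bfactor (f a) (f z)) <= 1 * N (bfactor a z).
  apply: (@schwarz_zero (fun y => bfactor (f a) (f y)) _ _ a1) z1.
  - by move=> y y1; exact: holo_bfactor_comp fa (hf y y1) (f1 y y1).
  - by move=> y y1; exact: bfactor_le1 fa (f1 y y1).
  - exact: bfactor_self.
by rewrite {1}/bfactor modulusM modulusV mul1r ler_pdivrMr// modulus_gt0 bfactor_den// f1.
Qed.

(** For [t < 1] the function [t * f] satisfies [schwarz_pick]; as [t] tends to 1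
    the two moduli in that inequality become equal because [N (f a) = 1], while
    the factor [N (bfactor a z)] stays below 1. *)
Lemma unimodular_cst (f : C -> C) (a : C) : N a < 1 ->
  holo_disc f -> bounded_disc f 1 -> N (f a) = 1 ->
  forall z, N z < 1 -> f z = f a.
Proof.
move=> a1 hf f1 fa z z1.
have H t : 0 < t < 1 -> N (f z - f a) * t <=
    N (bfactor a z) * N (1 - real_complex R (t ^+ 2) * (f a)^* * f z).
  move=> /andP[t0 t1].
  pose T := real_complex R t : C.
  have NT : N T = t by rewrite modulusR gtr0_norm.
  have := @schwarz_pick (fun y => T * f y) a a1 _ _ _ z z1.
  rewrite -mulrBr !modulusM NT [N (f z - f a) * t]mulrC.
  rewrite (_ : (T * f a)^* * (T * f z) = real_complex R (t ^+ 2) * (f a)^* * f z); last first.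
    rewrite rmorphM/= (_ : T^* = T); last by rewrite /T conjE oppr0.
    by rewrite /T rmorphXn/=; ring.
  apply.
  - by move=> y y1; apply: holoM; [exact: holo_cst|exact: hf].
  - move=> y y1; rewrite modulusM NT; have := f1 y y1.
    by have := modulus_ge0 (f y); nra.
  - by rewrite fa mulr1.
pose b := N (bfactor a z); pose X := N (f z - f a).
have b1 : b < 1 by exact: bfactor_lt1.
have b0 : 0 <= b by exact: modulus_ge0.
have den : N (1 - (f a)^* * f z) = X.
  rewrite /X -[RHS]mul1r -{1}fa -modulus_conj -modulusM mulrBr.
  by rewrite [_^* * f a]mulrC modulus_conjM fa expr1n modulusBC.
have H2 t : 0 < t < 1 -> X * t <= b * (X + 2 * (1 - t)).
  move=> t01; apply: le_trans (H t t01) _; apply: ler_wpM2l => //.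
  rewrite (_ : 1 - _ = 1 - (f a)^* * f z +
      real_complex R (1 - t ^+ 2) * ((f a)^* * f z)); last first.
    by rewrite rmorphB/= rmorph1; ring.
  apply: le_trans (modulusD _ _) _; rewrite den lerD2l !modulusM modulusR modulus_conj fa mul1r.
  have := f1 z z1; have := modulus_ge0 (f z).
  have [t0 t1] := andP t01.
  have t2 : 0 <= 1 - t ^+ 2 by nra.
  rewrite ger0_norm// => F0 F1.
  have : (1 - t ^+ 2) * N (f z) <= 1 - t ^+ 2 by rewrite ler_piMr.
  by nra.
have X0 : 0 <= X by exact: modulus_ge0.
suff : X <= 0.
  by move=> X1; apply/eqP; rewrite -subr_eq0 -modulus_eq0 eq_le -/X X1.
rewrite leNgt; apply/negP => Xp.
pose c := (1 - b) * X.
have c0 : 0 < c by rewrite mulr_gt0//; lra.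
pose t := Num.max (1 / 2) (1 - c / (2 * (X + 2))).
have t1 : t < 1 by rewrite gt_max; have : 0 < c / (2 * (X + 2)); [rewrite divr_gt0//; lra|lra].
have th : 1 / 2 <= t by rewrite le_max lexx.
have tc : (1 - t) * (X + 2) <= c / 2.
  have : 1 - c / (2 * (X + 2)) <= t by rewrite le_max lexx orbT.
  have -> : c / 2 = c / (2 * (X + 2)) * (X + 2) by field; rewrite gt_eqF//; lra.
  by move=> ?; rewrite ler_pM2r; lra.
have := H2 t ltac:(lra).
have : c / 2 < c by lra.
have : b * (2 * (1 - t)) <= 2 * (1 - t) by rewrite ler_piMl//; lra.
rewrite /c in tc *; lra.
Qed.

End MobiusFactor.

(** * Normal families in a normed space *)

Section NormalFamilies.
Variable R : realType.
Local Notation C := R[i].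
Local Notation N := modulus.
Variable V : normedModType C.
Local Notation holoV f x := (@holo_at R V f x).
Local Notation holo f x := (@holo_at R C^o f x).

(** A form of differentiability for a differential obtained as a limit, whose
    linearity is proved rather than packaged. *)
Lemma differentiable_linearP (f : V -> C) (x : V) (L : V -> C^o) (K : R) :
  linear L -> (forall h, N (L h) <= K * N h) ->
  (forall e : R, 0 < e -> exists2 d : R, 0 < d &
     forall h, N h < d -> N (f (x + h) - f x - L h) <= e * N h) ->
  holoV f x.
Proof.
move=> linL LK H.
pose L' : {linear V -> C^o} := HB.pack L (GRing.isLinear.Build _ _ _ _ L linL).
by apply/differentiable_modulusP; exists L'; split; [exists K|].
Qed.

Lemma open_ball_modulus (Omega : set V) (a : V) : open Omega -> Omega a ->
  exists2 r : R, 0 < r & forall x, N (x - a) < r -> Omega x.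
Proof. by move=> oO Oa; apply/nbhs_modulusP; apply: open_nbhs_nbhs; split. Qed.

Lemma holo_line (f : V -> C) (a h : V) (t : C) : holoV f (a + t *: h) ->
  holo (fun s => f (a + s *: h)) t.
Proof.
by move=> hf; apply: (@holo_comp R V C^o f (fun s : C^o => a + s *: h)).
Qed.

(** [quadratic_estimate] on the complex line through [a] in direction [h], at
    parameter 1, on a disc of radius [r / N h]. *)
Lemma quadratic_estimate_normed (f : V -> C) (a : V) (r : R) (L : {linear V -> C^o}) : 0 < r ->
  (forall x, N (x - a) < r -> holoV f x) ->
  (forall x, N (x - a) < r -> N (f x) <= 1) ->
  (forall e : R, 0 < e -> exists2 d : R, 0 < d &
     forall h, N h < d -> N (f (a + h) - f a - L h) <= e * N h) ->
  forall h, N h < r / 4 -> N (f (a + h) - f a - L h) * r ^+ 2 <= 16 * N h ^+ 2.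
Proof.
move=> r0 hf fM HL h hr.
have [->|h0] := eqVneq h 0.
  by rewrite addr0 subrr sub0r linear0 oppr0 !modulus0 mul0r expr0n/= mulr0.
have Nh : 0 < N h by rewrite modulus_gt0.
pose phi (s : C) := f (a + s *: h).
have inb (s : C) : N (s - 0) < r / N h -> N (a + s *: h - a) < r.
  by rewrite subr0 addrC addKr modulusZ ltr_pdivlMr.
have := @quadratic_estimate R phi 0 (L h) 1 (r / N h) 1.
rewrite /phi add0r scale0r addr0 scale1r mulr1 !modulus1 expr1n !mulr1.
rewrite expr_div_n mulrA ler_pdivrMr ?exprn_gt0//; apply.
- by rewrite divr_gt0.
- by move=> s /inb/hf; exact: holo_line.
- by move=> s /inb/fM.
- move=> e e0; have eN : 0 < e / N h by rewrite divr_gt0.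
  have [d d0 dP] := HL _ eN; exists (d / N h); first by rewrite divr_gt0.
  move=> s; rewrite ltr_pdivlMr// => sd; rewrite add0r.
  have := dP (s *: h); rewrite modulusZ => /(_ sd).
  rewrite linearZ/= mulrA [e / N h * _]mulrAC divfK ?gt_eqF//.
  by rewrite -[s *: L h]/(s * L h) [s * _]mulrC.
- by rewrite ltr_pdivlMr ?mul1r// in hr *; rewrite ltr_pdivlMr// ltr_pdivlMr//; lra.
Qed.

Lemma differential_bound (f : V -> C) (a : V) (r : R) (L : {linear V -> C^o}) : 0 < r ->
  (forall x, N (x - a) < r -> holoV f x) ->
  (forall x, N (x - a) < r -> N (f x) <= 1) ->
  (forall e : R, 0 < e -> exists2 d : R, 0 < d &
     forall h, N h < d -> N (f (a + h) - f a - L h) <= e * N h) ->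
  forall h, N (L h) <= 24 / r * N h.
Proof.
move=> r0 hf fM HL h.
have [->|h0] := eqVneq h 0; first by rewrite linear0 !modulus0 mulr0.
have Nh : 0 < N h by rewrite modulus_gt0.
pose t := r / 8 / N h; have t0 : 0 < t by rewrite !divr_gt0.
pose k := real_complex R t *: h.
have Nk : N k = r / 8.
  by rewrite modulusZ modulusR gtr0_norm// divfK// gt_eqF.
have := @quadratic_estimate_normed f a r L r0 hf fM HL k ltac:(rewrite Nk; lra).
rewrite Nk; set X := N _ => HX.
have X1 : X <= 1.
  have : 0 < r ^+ 2 by rewrite exprn_gt0.
  nra.
have A1 := fM a ltac:(by rewrite subrr modulus0).
have A2 := fM (a + k) ltac:(by rewrite addrC addKr Nk; lra).
have : N (L k) <= 3.
  have := modulusB (f (a + k) - f a) (f (a + k) - f a - L k).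
  have := modulusB (f (a + k)) (f a).
  rewrite (_ : f (a + k) - f a - (f (a + k) - f a - L k) = L k); last by ring.
  by rewrite -/X; lra.
rewrite /k linearZ/= modulusZ modulusR gtr0_norm//.
rewrite /t -ler_pdivlMl ?divr_gt0// => H; apply: le_trans H _.
rewrite !invfM !invrK; lra.
Qed.

(** The differentials at a point are uniformly bounded, so they have a pointwise
    limit, and the uniform quadratic estimate passes to the limit with it. *)
Lemma ultralimit_holo (Omega : set V) (f : nat -> V -> C) (g : V -> C)
    (U : set_system nat) (UU : UltraFilter U) : open Omega ->
  (forall n x, Omega x -> holoV (f n) x) ->
  (forall n x, Omega x -> N (f n x) <= 1) ->
  (forall x, Omega x -> ulim U (fun n => f n x) (g x)) ->
  forall x, Omega x -> holoV g x.
Proof.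
move=> oO hf f1 fg a Oa.
have [r r0 rO] := open_ball_modulus oO Oa.
have HL n : exists L : {linear V -> C^o}, (forall e : R, 0 < e -> exists2 d : R, 0 < d &
     forall h, N h < d -> N (f n (a + h) - f n a - L h) <= e * N h).
  by have /differentiable_modulusP[L [_ H]] := hf n a Oa; exists L.
have {HL} [L LP] := choice HL.
have hr n x : N (x - a) < r -> holoV (f n) x by move=> /rO; exact: hf.
have br n x : N (x - a) < r -> N (f n x) <= 1 by move=> /rO; exact: f1.
have Lb n := differential_bound r0 (hr n) (br n) (LP n).
have /choice[l lP] : forall h, exists l : C, ulim U (fun n => L n h) l.
  by move=> h; apply: (ulim_ex (M := 24 / r * N h)) => n; exact: Lb.
apply: (@differentiable_linearP g a l (24 / r)).
- move=> c u v; apply: (ulim_uniq (lP _)).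
  rewrite (_ : (fun n => L n (c *: u + v)) = (fun n => c * L n u + L n v)).
    exact: (ulimD (ulimZ c (lP u)) (lP v)).
  by apply/funext => n; rewrite linearP.
- by move=> h; apply: (ulim_modulus_le (lP h)).
move=> e e0; have r20 : 0 < r ^+ 2 by rewrite exprn_gt0.
have K0 : 0 < 16 / r ^+ 2 by rewrite divr_gt0.
exists (Num.min (r / 4) (e / (16 / r ^+ 2))); first by rewrite lt_min !divr_gt0.
move=> h; rewrite lt_min => /andP[hr4]; rewrite ltr_pdivlMr// => he.
have : N (g (a + h) - g a - l h) <= 16 / r ^+ 2 * N h ^+ 2.
  apply: (ulim_modulus_le (x := fun n => f n (a + h) - f n a - L n h)).
    apply: ulimB; last exact: lP.
    by apply: ulimB; apply: fg => //; apply: rO; rewrite addrC addKr; lra.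
  move=> n; rewrite mulrAC ler_pdivlMr//.
  exact: (quadratic_estimate_normed r0 (hr n) (br n) (LP n)).
have := modulus_ge0 h; nra.
Qed.

Lemma montel_disc (Omega : set V) (f : nat -> V -> C) : open Omega ->
  (forall n x, Omega x -> holoV (f n) x) ->
  (forall n x, Omega x -> N (f n x) <= 1) ->
  exists g : V -> C, [/\ (forall x, Omega x -> holoV g x),
    (forall x, Omega x -> N (g x) <= 1) &
    forall (x : V) (l : C), Omega x ->
      (forall e : R, 0 < e -> exists k, forall n, (k <= n)%N -> N (f n x - l) < e) -> g x = l].
Proof.
move=> oO hf f1; have [U UU Unat] := ultra_nat.
have /choice[g gP] : forall x, exists l : C, Omega x -> ulim U (fun n => f n x) l.
  move=> x; have [Ox|nOx] := pselect (Omega x); last by exists 0.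
  by have [l lP] := ulim_ex (U := U) (fun n => f1 n x Ox); exists l.
exists g; split.
- exact: (ultralimit_holo UU oO hf f1 gP).
- by move=> x Ox; apply: (ulim_modulus_le (gP x Ox)) => n; exact: f1.
- move=> x l Ox H; apply: (ulim_uniq (gP x Ox)) => e /H[k kP].
  by apply: filterS (Unat k) => n /=; exact: kP.
Qed.

(** The points of value inside the disc form an open set by continuity, and those
    of value on the circle form an open set by [unimodular_cst] on complex
    lines. *)
Lemma disc_valued (Omega : set V) (f : V -> C) (x0 : V) : open Omega -> connected Omega ->
  (forall x, Omega x -> holoV f x) -> (forall x, Omega x -> N (f x) <= 1) ->
  Omega x0 -> N (f x0) < 1 -> forall x, Omega x -> N (f x) < 1.
Proof.
move=> oO cO hf f1 Ox0 fx0.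
have oA : open [set x | Omega x /\ N (f x) < 1].
  rewrite openE => a /= [Oa fa]; apply/nbhs_modulusP.
  have [r r0 rO] := open_ball_modulus oO Oa.
  have e0 : 0 < 1 - N (f a) by lra.
  have /continuous_modulusP/(_ _ e0)[d d0 dP] := holo_cont (hf a Oa).
  exists (Num.min r d); first by rewrite lt_min r0.
  move=> x; rewrite lt_min => /andP[/rO Ox /dP fx]; split=> //.
  by have := modulusBr (f x) (f a); lra.
have oB : open [set x | Omega x /\ N (f x) = 1].
  rewrite openE => a /= [Oa fa]; apply/nbhs_modulusP.
  have [r r0 rO] := open_ball_modulus oO Oa.
  exists (r / 2); first by lra.
  move=> x xa; have Ox : Omega x by apply: rO; have := modulus_ge0 (x - a); lra.
  split=> //; pose h := (2 : C) *: (x - a).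
  have N2 : N (2 : C) = 2 by rewrite -(rmorph_nat (real_complex R) 2) modulusR ger0_norm.
  have Oh (s : C) : N s < 1 -> Omega (a + s *: h).
    move=> s1; apply: rO; rewrite addrC addKr !modulusZ N2.
    have := modulus_ge0 (x - a); have := modulus_ge0 s; nra.
  have := @unimodular_cst R (fun s => f (a + s *: h)) 0 _ _ _ _ (2^-1).
  rewrite modulus0 modulusV N2 scale0r addr0 /h scalerA mulVf ?scale1r; last first.
    by rewrite -modulus_eq0 N2.
  rewrite [a + _]addrC subrK => -> //; rewrite ?ltr01//; last by lra.
  - by move=> s /Oh/hf; exact: holo_line.
  - by move=> s /Oh/f1.
have -> : Omega = [set x | Omega x /\ N (f x) < 1].
  apply/esym; apply: cO; first by exists x0.
    exists [set x | Omega x /\ N (f x) < 1] => //.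
    by apply/seteqP; split=> x /=; tauto.
  exists (~` [set x | Omega x /\ N (f x) = 1]); first by rewrite closedC.
  apply/seteqP; split=> x /=.
    by move=> [Ox fx]; split=> // -[_ fx1]; rewrite fx1 ltxx in fx.
  move=> [Ox nfx]; split=> //; rewrite lt_neqAle f1// andbT.
  by apply/eqP => fx1; apply: nfx.
by move=> x [].
Qed.

End NormalFamilies.

(** * Interpolation on a general domain *)

Section PickGeneral.
Variable R : realType.
Local Notation C := R[i].
Local Notation N := modulus.

Lemma mobiusE (u v : C) : mobius u v = N (u - v) / N (1 - u^* * v).
Proof. by rewrite -modulusV -modulusM. Qed.

Lemma mobius_bfactor (u v : C) : mobius u v = N (bfactor u v).
Proof. by rewrite mobiusE /bfactor modulusM modulusV modulusBC. Qed.

Lemma mobius_ge0 (u v : C) : 0 <= mobius u v.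
Proof. by rewrite mobius_bfactor modulus_ge0. Qed.

Lemma mobius_le1 (u v : C) : N u < 1 -> N v < 1 -> mobius u v <= 1.
Proof. by move=> u1 v1; rewrite mobius_bfactor bfactor_le1// ltW. Qed.

Lemma mobius_gt0 (u v : C) : N u < 1 -> N v < 1 -> u <> v -> 0 < mobius u v.
Proof.
by move=> u1 v1 uv; rewrite mobius_bfactor modulus_gt0 bfactor_eq0//; apply/eqP => /esym.
Qed.

(** With [a = u^* v] and [t = N c], the claim reduces to
    [t^2 |1 - a|^2 + (1 - t^2)^2 <= |1 - t^2 a|^2], valid for [|a| <= 1]; since
    [|1 - a| <= 2], the second term on the left is a fixed proportion of the
    first. *)
Lemma mobius_contract (t0 : R) : 0 <= t0 -> t0 < 1 -> exists q : R, [/\ 0 <= q, q < 1 &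
  forall c u v : C, N c <= t0 -> N u < 1 -> N v < 1 ->
    mobius (c * u) (c * v) <= q * mobius u v].
Proof.
move=> t00 t01; pose s := (1 - t0 ^+ 2) ^+ 2.
have s0 : 0 < s by rewrite exprn_gt0// subr_gt0 sqr_lt1.
pose q := Num.sqrt (4 / (4 + s)).
have q2 : q ^+ 2 = 4 / (4 + s) by rewrite sqr_sqrtr// divr_ge0//; lra.
have q0 : 0 <= q by exact: sqrtr_ge0.
exists q; split=> //.
  by rewrite -sqr_lt1// q2 ltr_pdivrMr; lra.
move=> c u v ct u1 v1.
have c0 := modulus_ge0 c.
have cu x : N x < 1 -> N (c * x) < 1.
  by move=> x1; rewrite modulusM; have := modulus_ge0 x; nra.
have d0 : 0 < N (1 - u^* * v) by rewrite modulus_gt0 bfactor_den// ltW.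
have e0 : 0 < N (1 - (c * u)^* * (c * v)).
  by rewrite modulus_gt0 bfactor_den ?cu// ltW// cu.
rewrite !mobiusE -mulrBr modulusM ler_pdivrMr//.
rewrite (_ : q * (N (u - v) / N (1 - u^* * v)) * N (1 - (c * u)^* * (c * v)) =
  q * N (1 - (c * u)^* * (c * v)) * N (u - v) / N (1 - u^* * v)); last first.
  by field; rewrite gt_eqF.
rewrite ler_pdivlMr//.
suff H : N c * N (1 - u^* * v) <= q * N (1 - (c * u)^* * (c * v)).
  by rewrite mulrAC ler_wpM2r ?modulus_ge0.
rewrite -(@ler_pXn2r _ 2) ?nnegrE ?mulr_ge0 ?modulus_ge0// !exprMn q2.
have -> : (c * u)^* * (c * v) = real_complex R (N c ^+ 2) * (u^* * v).
  by rewrite -modulus_conjM rmorphM/=; ring.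
have a1 : N (u^* * v) <= 1.
  rewrite modulusM modulus_conj; have := modulus_ge0 u; have := modulus_ge0 v; nra.
move: (N c) c0 ct => t {}c0 ct; move: (u^* * v) a1 => [a b] a1.
have : N (Complex a b) ^+ 2 <= 1 by rewrite sqr_le1// modulus_ge0.
rewrite !modulus_sqr /= => ab.
have st : s <= (1 - t ^+ 2) ^+ 2.
  have : t ^+ 2 <= t0 ^+ 2 by rewrite ler_pXn2r ?nnegrE//; lra.
  have : t0 ^+ 2 < 1 by rewrite sqr_lt1.
  by rewrite /s !expr2; nra.
have t2 : t ^+ 2 < 1 by rewrite sqr_lt1//; lra.
rewrite [leRHS]mulrAC ler_pdivlMr; last by lra.
set X := (1 - a) ^+ 2 + (0 - b) ^+ 2.
have X0 : 0 <= X by rewrite addr_ge0 ?sqr_ge0.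
have X4 : X <= 4 by rewrite /X; nra.
have Y : t ^+ 2 * X + (1 - t ^+ 2) ^+ 2 <=
   (1 - (t ^+ 2 * a - 0 * b)) ^+ 2 + (0 - (t ^+ 2 * b + 0 * a)) ^+ 2.
  have : 0 <= t ^+ 2 * (1 - t ^+ 2) * (1 - a ^+ 2 - b ^+ 2).
    by rewrite !mulr_ge0 ?sqr_ge0//; lra.
  by rewrite /X; nra.
have : t ^+ 2 * X * s <= 4 * s.
  by rewrite ler_wpM2r//; nra.
nra.
Qed.

Lemma mobius_scale_lt (c u v : C) : N c < 1 -> N u < 1 -> N v < 1 -> u <> v ->
  mobius (c * u) (c * v) < mobius u v.
Proof.
move=> c1 u1 v1 uv.
have [q [q0 q1 qP]] := mobius_contract (modulus_ge0 c) c1.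
apply: le_lt_trans (qP c u v (lexx _) u1 v1) _.
by rewrite gtr_pMl// mobius_gt0.
Qed.

Lemma mobius_scale_le (c u v : C) : N c <= 1 -> N u < 1 -> N v < 1 ->
  mobius (c * u) (c * v) <= mobius u v.
Proof.
rewrite le_eqVlt => /predU1P[c1|c1] u1 v1.
  rewrite !mobiusE -mulrBr modulusM c1 mul1r.
  by rewrite rmorphM/= mulrACA [_^* * c]mulrC modulus_conjM c1 expr1n mul1r.
have [q [q0 q1 qP]] := mobius_contract (modulus_ge0 c) c1.
apply: le_trans (qP c u v (lexx _) u1 v1) _.
by rewrite ler_piMl ?mobius_ge0// ltW.
Qed.

Variable V : normedModType C.
Local Notation holoV f x := (@holo_at R V f x).
Variables (Omega : set V) (n : nat) (z : 'I_n -> V) (w : 'I_n -> C).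
Hypothesis Oz : forall k, Omega (z k).
Hypothesis w1 : forall k, N (w k) < 1.

Lemma pick_dist_ge (f : V -> C) (c : C) i j : hol_disc Omega f ->
  (forall k, f (z k) = c * w k) ->
  mobius (f (z i)) (f (z j)) <= pick_dist Omega z w i j.
Proof.
move=> hf fc; apply: ub_le_sup; last by exists f => //; split=> //; exists c.
exists 1 => _ [g [[_ hg] _] <-].
by apply: mobius_le1; apply/discE/hg.
Qed.

Lemma pick_dist_lt_ex (i j : 'I_n) (b : R) : b < pick_dist Omega z w i j ->
  exists f c, [/\ hol_disc Omega f, forall k, f (z k) = c * w k &
     b < mobius (f (z i)) (f (z j))].
Proof.
move=> bd.
have /sup_gt : b < pick_dist Omega z w i j by [].
case.
  exists (mobius 0 0); exists (fun=> 0) => //; split.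
    split=> x _; first exact: holo_cst.
    by apply/discE; rewrite modulus0.
  by exists 0 => k; rewrite mul0r.
by move=> _ [f [hf [c fc]] <-] ?; exists f, c.
Qed.

(** The contraction factor [q] of [t] turns near-optimality into [t < N c], and
    then rescaling by [t / c] stays in the disc. *)
Lemma scaled_solvable (i j : 'I_n) (t : R) : w i <> w j -> 0 <= t -> t < 1 ->
  mobius (w i) (w j) <= pick_dist Omega z w i j ->
  pick_solvable Omega z (fun k => real_complex R t * w k).
Proof.
move=> wij t0 t1 md.
have [q [q0 q1 qP]] := mobius_contract t0 t1.
have m0 := mobius_gt0 (w1 i) (w1 j) wij.
have qm : q * mobius (w i) (w j) < pick_dist Omega z w i j.
  by apply: lt_le_trans md; rewrite gtr_pMl.
have [f [c [[hf fd] fc fm]]] := pick_dist_lt_ex qm.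
have ct : t < N c.
  rewrite ltNge; apply/negP => ct; move: fm; rewrite !fc ltNge => /negP; apply.
  exact: qP.
have c0 : c != 0 by rewrite -modulus_gt0; lra.
exists (fun x => real_complex R t / c * f x); split; last first.
  by move=> k; rewrite fc mulrA divfK.
split=> x Ox; first by apply: holoM; [exact: holo_cst|exact: hf].
apply/discE; have /discE fx := fd x Ox.
rewrite modulusM modulusM modulusV modulusR ger0_norm//.
have : t / N c < 1 by rewrite ltr_pdivrMr; lra.
have : 0 <= t / N c by rewrite divr_ge0// modulus_ge0.
by have := modulus_ge0 (f x); nra.
Qed.

Lemma closed_disc_solution (i j : 'I_n) : open Omega -> w i <> w j ->
  mobius (w i) (w j) <= pick_dist Omega z w i j ->
  exists f : V -> C, [/\ (forall x, Omega x -> holoV f x),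
    (forall x, Omega x -> N (f x) <= 1) & forall k, f (z k) = w k].
Proof.
move=> oO wij md.
pose t m : R := 1 - m.+1%:R^-1.
have t0 m : 0 <= t m by rewrite subr_ge0 invf_le1 ?ltr0Sn// ler1n.
have t1 m : t m < 1 by rewrite gtrBl invr_gt0 ltr0Sn.
have /choice[f fP] : forall m, exists f, hol_disc Omega f /\
    forall k, f (z k) = real_complex R (t m) * w k.
  by move=> m; exact: scaled_solvable wij (t0 m) (t1 m) md.
have hf m x : Omega x -> holoV (f m) x by have [[+ _] _] := fP m; apply.
have f1 m x : Omega x -> N (f m x) <= 1.
  by have [[_ fd] _] := fP m => /fd/discE/ltW.
have [g [hg g1 gP]] := montel_disc oO hf f1.
exists g; split=> // k; apply: gP => // e e0.
exists (Num.truncn e^-1) => m km; have [_ ->] := fP m.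
rewrite -[X in _ - X]mul1r -mulrBl modulusM -(rmorph1 (real_complex R)) -rmorphB/=.
rewrite modulusR /t addrAC subrr add0r normrN ger0_norm ?invr_ge0//.
apply: le_lt_trans (_ : m.+1%:R^-1 < e); first by rewrite ler_piMr ?invr_ge0// ltW.
rewrite invf_plt ?posrE ?ltr0Sn//.
by apply: lt_le_trans (truncnS_gt _) _; rewrite ler_nat ltnS.
Qed.

Lemma pick_criterion : domain Omega ->
  pick_solvable Omega z w <->
  (forall i j, w i = w j) \/
  (exists i j, w i <> w j /\ mobius (w i) (w j) <= pick_dist Omega z w i j).
Proof.
move=> [_ oO cO]; split.
  move=> [f [hf fw]].
  have [|nall] := pselect (forall i j, w i = w j); [by left|right].
  move/existsNP : nall => [i /existsNP[j wij]]; exists i, j; split=> //.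
  rewrite -!fw; apply: (pick_dist_ge (c := 1)) => // k.
  by rewrite mul1r.
move=> [wc|[i [j [wij md]]]].
  have [n0|n0] := posnP n.
    exists (fun=> 0); split; last by move=> k; move: (ltn_ord k); rewrite {2}n0.
    split=> x _; [exact: holo_cst|apply/discE; by rewrite modulus0].
  pose k0 := Ordinal n0; exists (fun=> w k0); split=> [|k]; last exact: wc.
  by split=> x _; [exact: holo_cst|apply/discE].
have [f [hf f1 fw]] := closed_disc_solution oO wij md.
exists f; split=> //; split=> // x Ox; apply/discE.
by apply: (disc_valued oO cO hf f1 (Oz i)) => //; rewrite fw.
Qed.

End PickGeneral.

(** * Finite Blaschke products *)

Section BlaschkeProducts.
Variable R : realType.
Local Notation C := R[i].
Local Notation N := modulus.

Definition bprod (c : C) (s : seq C) (x : C) : C := c * \prod_(a <- s) bfactor a x.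

Definition in_disc (s : seq C) := forall a, a \in s -> N a < 1.

Lemma blaschkeP k (B : C -> C) : blaschke k B <->
  exists c s, [/\ N c = 1, in_disc s, size s = k &
    forall x, N x < 1 -> B x = bprod c s x].
Proof.
split.
  move=> [c [a [c1 a1 BE]]]; exists c, [seq a l | l <- enum 'I_k]; split.
  - by rewrite /modulus c1.
  - by move=> _ /mapP[l _ ->]; apply/discE.
  - by rewrite size_map size_enum_ord.
  - by move=> x /discE/BE ->; rewrite /bprod big_map big_enum.
move=> [c [s [c1 s1 sk BE]]]; subst k; exists c, (fun l : 'I_(size s) => nth 0 s l); split.
- by rewrite normC_modulus c1.
- by move=> l; apply/discE/s1/mem_nth.
- by move=> x /discE/BE ->; rewrite /bprod (big_nth 0) big_mkord.
Qed.

(** Numerator and denominator of a finite Blaschke product. *)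
Definition num_poly (s : seq C) : {poly C} := \prod_(a <- s) ('X - a%:P).
Definition den_poly (s : seq C) : {poly C} := \prod_(a <- s) (1 - a^* *: 'X).

Lemma horner_num_poly s x : (num_poly s).[x] = \prod_(a <- s) (x - a).
Proof. by rewrite horner_prod; apply: eq_bigr => a _; rewrite !hornerE. Qed.

Lemma horner_den_poly s x : (den_poly s).[x] = \prod_(a <- s) (1 - a^* * x).
Proof. by rewrite horner_prod; apply: eq_bigr => a _; rewrite !hornerE. Qed.

Lemma den_poly_top s : (size (den_poly s) <= (size s).+1)%N /\
  (den_poly s)`_(size s) = \prod_(a <- s) (- a^*).
Proof.
rewrite /den_poly; elim: s => [|a s [IHs IHc]].
  by rewrite !big_nil size_poly1 coef1.
rewrite !big_cons mulrBl mul1r -scalerAl /=; split.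
  apply: leq_trans (size_polyD _ _) _; rewrite geq_max (leq_trans IHs)//=.
  rewrite size_polyN; apply: leq_trans (size_scale_leq _ _) _.
  by apply: leq_trans (size_polyMleq _ _) _; rewrite size_polyX.
by rewrite coefB nth_default// coefZ coefXM/= IHc sub0r mulNr.
Qed.

Lemma den_poly_neq0 s x : in_disc s -> N x <= 1 -> (den_poly s).[x] != 0.
Proof.
move=> s1 x1; rewrite horner_den_poly; elim: s s1 => [|a s IH] s1.
  by rewrite big_nil oner_neq0.
rewrite big_cons mulf_neq0//.
  by apply: bfactor_den => //; apply: s1; rewrite mem_head.
by apply: IH => b bs; apply: s1; rewrite in_cons bs orbT.
Qed.

Lemma bprodE c s x : bprod c s x = c * (num_poly s).[x] / (den_poly s).[x].
Proof. by rewrite /bprod horner_num_poly horner_den_poly prodf_div mulrA. Qed.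

(** Reflection in the unit circle exchanges numerator and denominator. *)
Lemma den_poly_reflect s x : x != 0 -> (den_poly s).[x] = x ^+ size s * ((num_poly s).[(x^*)^-1])^*.
Proof.
move=> x0; rewrite horner_den_poly horner_num_poly; elim: s => [|a s IH].
  by rewrite !big_nil expr0 rmorph1 mulr1.
rewrite !big_cons IH rmorphM rmorphB/= fmorphV/= conjCK exprS.
by field.
Qed.

Lemma num_poly_reflect s x : x != 0 -> (num_poly s).[x] = x ^+ size s * ((den_poly s).[(x^*)^-1])^*.
Proof.
move=> x0; have y0 : (x^*)^-1 != 0 by rewrite invr_eq0 conjC_eq0.
rewrite (den_poly_reflect s y0) fmorphV/= conjCK invrK rmorphM rmorphXn/= conjCK.
by rewrite fmorphV/= conjCK mulrA -exprMn divff// expr1n mul1r.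
Qed.

Lemma modulus_den_poly_le s x : in_disc s -> 1 <= N x -> N (den_poly s).[x] <= N (num_poly s).[x].
Proof.
move=> s1 x1; rewrite horner_den_poly horner_num_poly; elim: s s1 => [|a s IH] s1.
  by rewrite !big_nil.
rewrite !big_cons !modulusM; apply: ler_pM; rewrite ?modulus_ge0//; last first.
  by apply: IH => b bs; apply: s1; rewrite in_cons bs orbT.
have a1 : N a < 1 by apply: s1; rewrite mem_head.
rewrite -(@ler_pXn2r _ 2) ?nnegrE ?modulus_ge0// -subr_le0 bfactor_sqr.
rewrite mulr_ge0_le0// ?subr_ge0 ?subr_le0; first by rewrite ltW// sqr_lt1// modulus_ge0.
by rewrite exprn_ege1.
Qed.

(** Automorphisms of the disc preserve Blaschke products of a given degree.  The
    numerator [T] of the composite has all its roots in the disc, because outside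
    the disc the original numerator dominates the original denominator; the new
    denominator is then the reflection of [T]. *)
Lemma bprod_mobius (w c : C) (s : seq C) : N w < 1 -> N c = 1 -> in_disc s ->
  exists c' s', [/\ N c' = 1, in_disc s', size s' = size s &
    forall x, N x < 1 -> bfactor w (bprod c s x) = bprod c' s' x].
Proof.
move=> w1 c1 s1.
pose T := c *: num_poly s - w *: den_poly s.
have [szQ cQ] := den_poly_top s.
pose la := c - w * \prod_(a <- s) (- a^*).
have cP : (num_poly s)`_(size s) = 1.
  rewrite -[RHS](monicP (monic_prod_XsubC s xpredT id)).
  by rewrite lead_coefE size_prod_XsubC.
have Tk : T`_(size s) = la by rewrite coefB !coefZ cQ cP mulr1.
(* [la] is the leading coefficient of [T]; it does not vanish, so no root is lost
   and the degree is unchanged. *)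
have prod_le1 (v : seq C) : in_disc v -> N (\prod_(a <- v) (- a^*)) <= 1.
  elim: v => [|a v IH] v1; first by rewrite big_nil modulus1.
  rewrite big_cons modulusM modulusN modulus_conj mulr_ile1 ?modulus_ge0//.
    by rewrite ltW// v1// mem_head.
  by apply: IH => b bs; apply: v1; rewrite in_cons bs orbT.
have la0 : la != 0.
  rewrite -modulus_gt0; have := modulusBr c (w * \prod_(a <- s) (- a^*)).
  rewrite c1 modulusM -/la; have := prod_le1 s s1.
  have := modulus_ge0 w; have := modulus_ge0 (\prod_(a <- s) (- a^*)); nra.
have szT : size T = (size s).+1.
  apply/eqP; rewrite eqn_leq; apply/andP; split.
    apply: leq_trans (size_polyD _ _) _; rewrite size_polyN geq_max.
    rewrite (leq_trans (size_scale_leq _ _)) ?size_prod_XsubC//=.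
    by rewrite (leq_trans (size_scale_leq _ _)).
  rewrite ltnNge; apply/negP => /(nth_default 0); rewrite Tk => la00.
  by rewrite la00 eqxx in la0.
have lT : lead_coef T = la by rewrite lead_coefE szT.
have [r rT] := closed_field_poly_normal T; rewrite lT in rT.
have szr : size r = size s.
  by move: szT; rewrite rT size_scale// size_prod_XsubC => -[].
have r1 : in_disc r.
  move=> rho rr; rewrite ltNge; apply/negP => rho1.
  have : T.[rho] = 0.
    apply/rootP; rewrite rT rootE hornerZ mulf_eq0; apply/orP; right.
    by rewrite -rootE root_prod_XsubC.
  rewrite hornerD hornerN !hornerZ => /eqP; rewrite subr_eq0 => /eqP TE.
  have := modulusM c (num_poly s).[rho]; rewrite TE modulusM c1 mul1r => E.
  have z0 : 0 < N (num_poly s).[rho].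
    rewrite modulus_gt0 horner_num_poly prodf_seq_neq0.
    apply/allP => a /s1 a1 /=; rewrite subr_eq0; apply/eqP => ra.
    by move: a1; rewrite -ra ltNge rho1.
  have := modulus_den_poly_le s1 rho1; have := modulus_ge0 w; nra.
(* At 0 the reflection formula says nothing and the two sides are compared by
   their constant terms. *)
have den x : (den_poly s).[x] - w^* * (c * (num_poly s).[x]) = c * la^* * (den_poly r).[x].
  have cc : c * c^* = 1 by rewrite modulus_conjM c1 expr1n.
  have [->|x0] := eqVneq x 0.
    rewrite !horner_den_poly horner_num_poly.
    have p0 (v : seq C) : \prod_(a <- v) (1 - a^* * 0) = 1.
      by rewrite big1// => a _; rewrite mulr0 subr0.
    rewrite !p0 mulr1 /la rmorphB rmorphM/= rmorph_prod/= mulrBr cc.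
    rewrite (eq_bigr (fun a : C => - a)) => [|a _]; last by rewrite sub0r.
    congr (1 - _); rewrite mulrCA; congr (_ * (_ * _)).
    by apply: eq_bigr => a _; rewrite rmorphN/= conjCK.
  have : (T.[(x^*)^-1])^* = (la * (num_poly r).[(x^*)^-1])^* by rewrite {1}rT hornerZ.
  rewrite hornerD hornerN !hornerZ rmorphB !rmorphM/= => H.
  rewrite (den_poly_reflect r x0) szr (den_poly_reflect s x0) (num_poly_reflect s x0).
  have -> : c * la^* * (x ^+ size s * ((num_poly r).[(x^*)^-1])^*) =
    c * x ^+ size s * (la^* * ((num_poly r).[(x^*)^-1])^*) by ring.
  rewrite -H; set P := (_.[_])^*; set Q := (_.[_])^*.
  rewrite mulrBr; congr (_ - _); last by ring.
  by rewrite mulrA [c * _ * _]mulrAC cc mul1r.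
exists (la / (c * la^*)), r; split=> //.
  by rewrite modulusM modulusV modulusM modulus_conj c1 mul1r divff// gt_eqF// modulus_gt0.
move=> x x1; have q0 := den_poly_neq0 s1 (ltW x1); have q'0 := den_poly_neq0 r1 (ltW x1).
have c0 : c != 0 by rewrite -modulus_gt0 c1.
have la'0 : la^* != 0 by rewrite conjC_eq0.
rewrite !bprodE /bfactor.
have -> : c * (num_poly s).[x] / (den_poly s).[x] - w = la * (num_poly r).[x] / (den_poly s).[x].
  have : T.[x] = la * (num_poly r).[x] by rewrite rT hornerZ.
  by rewrite hornerD hornerN !hornerZ => <-; field.
have -> : 1 - w^* * (c * (num_poly s).[x] / (den_poly s).[x]) =
    c * la^* * (den_poly r).[x] / (den_poly s).[x].
  by rewrite -den; field.
by field; rewrite q0 q'0 c0 la'0.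
Qed.

Lemma bprod_factor (c : C) (s : seq C) (a : C) : N c = 1 -> in_disc s -> N a < 1 ->
  bprod c s a = 0 -> exists s', [/\ in_disc s', size s = (size s').+1 &
    forall x, bprod c s x = bfactor a x * bprod c s' x].
Proof.
move=> c1 s1 a1 /eqP; rewrite /bprod mulf_eq0 -modulus_eq0 c1 oner_eq0/=.
rewrite prodf_seq_eq0 => /hasP[b bs /=]; rewrite bfactor_eq0//; last exact: s1.
move=> /eqP ab.
subst b; exists (rem a s); split.
- by move=> y /mem_rem/s1.
- by rewrite (perm_size (perm_to_rem bs)).
- by move=> x; rewrite (big_rem a bs)/= mulrCA.
Qed.

Lemma bprod_lt1 c s x : N c = 1 -> in_disc s -> s != [::] -> N x < 1 -> N (bprod c s x) < 1.
Proof.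
move=> c1 + + x1; rewrite /bprod modulusM c1 mul1r.
case: s => // a s s1 _; elim: s a s1 => [|b s IH] a s1.
  by rewrite big_seq1 bfactor_lt1// s1// mem_head.
rewrite big_cons modulusM mulr_ilt1 ?modulus_ge0//.
  by rewrite bfactor_lt1// s1// mem_head.
by apply: IH => y ys; apply: s1; rewrite in_cons ys orbT.
Qed.

Lemma holo_bprod c s : in_disc s -> holo_disc (bprod c s).
Proof.
move=> s1 x x1; apply: holoM; first exact: holo_cst.
elim: s s1 => [|a s IH] s1.
  rewrite (_ : (fun y => _) = (fun=> 1)); first exact: holo_cst.
  by apply/funext => y; rewrite big_nil.
rewrite (_ : (fun y => _) = (fun y => bfactor a y * \prod_(a <- s) bfactor a y)); last first.
  by apply/funext => y; rewrite big_cons.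
apply: holoM; first by apply: holo_bfactor; [apply: s1; rewrite mem_head|exact: ltW].
by apply: IH => b bs; apply: s1; rewrite in_cons bs orbT.
Qed.

End BlaschkeProducts.

(** * The Schur algorithm and extremal interpolation on the disc *)

Section SchurAlgorithm.
Variable R : realType.
Local Notation C := R[i].
Local Notation N := modulus.

(** Stronger than being disc-valued: the room left below 1 is what
    [strict_solution_lt] exploits. *)
Definition strictly_bounded (g : C -> C) := exists2 r : R, r < 1 & bounded_disc g r.

(** By [bfactor_sqr], [1 - N (bfactor w y) ^+ 2] is at least
    [(1 - N w ^+ 2) * (1 - r ^+ 2) / 4], the denominator being at most 2. *)
Lemma bfactor_strict (w : C) (r : R) : N w < 1 -> r < 1 -> exists2 r' : R, r' < 1 &
  forall y, N y <= r -> N (bfactor w y) <= r'.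
Proof.
move=> w1 r1; pose s := (1 - N w ^+ 2) * (1 - r ^+ 2) / 4.
have [r0|r0] := ltP r 0.
  by exists 0 => // y yr; have := modulus_ge0 y; lra.
have w2 : N w ^+ 2 < 1 by rewrite sqr_lt1 ?modulus_ge0.
have r2 : r ^+ 2 < 1 by rewrite sqr_lt1.
have w20 : 0 <= N w ^+ 2 by exact: sqr_ge0.
have r20 : 0 <= r ^+ 2 by exact: sqr_ge0.
have s0 : 0 < s by rewrite !mulr_gt0//; lra.
have s1 : s < 1 by rewrite /s; nra.
exists (Num.sqrt (1 - s)).
  by rewrite -sqr_lt1 ?sqrtr_ge0// sqr_sqrtr; lra.
move=> y yr; have y1 : N y < 1 by lra.
have d0 : 0 < N (1 - w^* * y) by rewrite modulus_gt0 bfactor_den// ltW.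
rewrite -(@ler_pXn2r _ 2) ?nnegrE ?modulus_ge0 ?sqrtr_ge0// sqr_sqrtr; last by lra.
rewrite /bfactor modulusM modulusV expr_div_n ler_pdivrMr ?exprn_gt0//.
have := bfactor_sqr w y.
have d2 : N (1 - w^* * y) ^+ 2 <= 4.
  have : N (1 - w^* * y) <= 2.
    apply: le_trans (modulusB _ _) _; rewrite modulus1 modulusM modulus_conj.
    have := modulus_ge0 w; have := modulus_ge0 y; nra.
  by rewrite expr2; nra.
have y2 : N y ^+ 2 <= r ^+ 2 by rewrite ler_pXn2r ?nnegrE ?modulus_ge0.
have : s * N (1 - w^* * y) ^+ 2 <= s * 4 by rewrite ler_pM2l.
have : (1 - N w ^+ 2) * (1 - r ^+ 2) <= (1 - N w ^+ 2) * (1 - N y ^+ 2).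
  by rewrite ler_wpM2l; lra.
rewrite /s; lra.
Qed.

Lemma strict_bfactor (g : C -> C) (w : C) : N w < 1 -> strictly_bounded g ->
  strictly_bounded (fun z => bfactor w (g z)).
Proof.
move=> w1 [r r1 gr]; have [r' r'1 H] := bfactor_strict w1 r1.
by exists r' => // z /gr/H.
Qed.

(** The first node is removed from both functions at once: the product loses a
    factor, and the other function stays strictly bounded by
    [schwarz_factor]. *)
Lemma blaschke_not_strict (zs : seq C) (s : seq C) (f : C -> C) (c : C) :
  N c = 1 -> in_disc s -> uniq zs -> in_disc zs -> (size s < size zs)%N ->
  holo_disc f -> strictly_bounded f -> (forall z, z \in zs -> f z = bprod c s z) -> False.
Proof.
elim: zs s f c => [//|a zs IH] s f c c1 s1 /= /andP[azs uzs] zs1 szs hf fs fE.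
have a1 : N a < 1 by apply: zs1; rewrite mem_head.
have zs1' : in_disc zs by move=> z zzs; apply: zs1; rewrite in_cons zzs orbT.
have [r r1 fr] := fs.
have fa := fE a (mem_head _ _).
have w1 : N (f a) < 1 by apply: le_lt_trans (fr a a1) r1.
have [c' [s' [c'1 s'1 ss' BE]]] := bprod_mobius w1 c1 s1.
have B0 : bprod c' s' a = 0 by rewrite -BE// -fa bfactor_self.
have [s'' [s''1 ss'' BE']] := bprod_factor c'1 s'1 a1 B0.
have [r' r'1 Fr'] := strict_bfactor w1 fs.
have hF : holo_disc (fun z => bfactor (f a) (f z)).
  move=> z z1; apply: (holo_bfactor_comp w1 (hf z z1)).
  exact: le_trans (fr z z1) (ltW r1).
have [g [hg gr' gE]] := schwarz_factor a1 hF Fr' (bfactor_self (f a)).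
have ssz : (size s'' < size zs)%N by move: szs; rewrite -ss' ss''.
have gs : strictly_bounded g by exists r'.
apply: (IH s'' g c' c'1 s''1 uzs zs1' ssz hg gs).
move=> z zzs; have z1 := zs1' z zzs.
have za : z != a by apply/eqP => za; rewrite -za zzs in azs.
have b0 : bfactor a z != 0 by rewrite bfactor_eq0.
by apply: (mulfI b0); rewrite -BE' -BE// -fE ?in_cons ?zzs ?orbT// gE.
Qed.

(** After removing the first node, a strictly bounded solution of the reduced
    problem would lift to one of the original problem, so the hypothesis is
    inherited; a Blaschke product solving the reduced problem lifts to one with
    one more factor. *)
Lemma schur_algorithm (zs : seq C) (f : C -> C) :
  uniq zs -> in_disc zs -> (0 < size zs)%N -> holo_disc f -> bounded_disc f 1 ->
  ~ (exists g, [/\ holo_disc g, strictly_bounded g & forall z, z \in zs -> g z = f z]) ->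
  exists c s, [/\ N c = 1, in_disc s, (size s < size zs)%N &
     forall z, z \in zs -> f z = bprod c s z].
Proof.
elim: zs f => [//|a zs IH] f /= /andP[azs uzs] zs1 _ hf f1 nstrict.
have a1 : N a < 1 by apply: zs1; rewrite mem_head.
have zs1' : in_disc zs by move=> z zzs; apply: zs1; rewrite in_cons zzs orbT.
have := f1 a a1; rewrite le_eqVlt => /predU1P[fa|w1].
  exists (f a), [::]; split=> // z /zs1 z1.
  by rewrite /bprod big_nil mulr1 (unimodular_cst a1 hf f1 fa).
have Nw1 : N (- f a) < 1 by rewrite modulusN.
have za z : z \in zs -> z != a.
  by move=> zzs; apply/eqP => za; rewrite -za zzs in azs.
have hF : holo_disc (fun z => bfactor (f a) (f z)).
  by move=> z z1; exact: holo_bfactor_comp w1 (hf z z1) (f1 z z1).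
have F1 : bounded_disc (fun z => bfactor (f a) (f z)) 1.
  by move=> z z1; apply: bfactor_le1 => //; exact: f1.
have [g [hg g1 gE]] := schwarz_factor a1 hF F1 (bfactor_self (f a)).
have [zs0|zs_gt0] := posnP (size zs).
  case: nstrict; exists (fun=> f a); split.
  - by move=> z z1; exact: holo_cst.
  - by exists (N (f a)).
  - by move=> z; rewrite (size0nil zs0) inE => /eqP ->.
have [] := IH g uzs zs1' zs_gt0 hg g1.
  move=> [h [hh [r r1 hr] hE]]; apply: nstrict.
  pose G z := bfactor a z * h z.
  have Gs : strictly_bounded G.
    exists r => // z z1; rewrite /G modulusM; have := hr z z1.
    have := bfactor_lt1 a1 z1; have := modulus_ge0 (bfactor a z); have := modulus_ge0 (h z); nra.
  have [r' r'1 Gr'] := Gs.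
  exists (fun z => bfactor (- f a) (G z)); split.
  - move=> z z1; apply: (holo_bfactor_comp Nw1).
      by apply: holoM; [exact: holo_bfactor a1 (ltW z1)|exact: hh].
    exact: le_trans (Gr' z z1) (ltW r'1).
  - exact: strict_bfactor.
  - move=> z; rewrite in_cons => /predU1P[->|zzs].
      by rewrite /G bfactor_self mul0r /bfactor sub0r opprK mulr0 subr0 divr1.
    have z1 := zs1' z zzs.
    by rewrite /G hE// -gE// bfactorK//; exact: f1.
move=> c [s [c1 s1 ssz sE]].
have as1 : in_disc (a :: s).
  by move=> y; rewrite in_cons => /predU1P[->//|]; exact: s1.
have [c' [s' [c'1 s'1 ss' BE]]] := bprod_mobius Nw1 c1 as1.
have bE z : bprod c (a :: s) z = bfactor a z * bprod c s z.
  by rewrite /bprod big_cons mulrCA.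
exists c', s'; split=> //; first by rewrite ss'.
move=> z zzs; have z1 := zs1 z zzs; rewrite -BE// bE.
move: zzs; rewrite in_cons => /predU1P[->|zzs].
  by rewrite bfactor_self mul0r /bfactor sub0r opprK mulr0 subr0 divr1.
by rewrite -sE// -gE// bfactorK//; exact: f1.
Qed.

Section Disc.
Variables (n : nat) (z : 'I_n -> C) (w : 'I_n -> C).
Hypothesis z1 : forall k, N (z k) < 1.
Hypothesis w1 : forall k, N (w k) < 1.
Hypothesis z_inj : injective z.
Hypothesis n_gt0 : (0 < n)%N.

Local Notation D := (@disc R : set C^o).

Let zs := [seq z k | k <- enum 'I_n].

Let zs_uniq : uniq zs.
Proof. by rewrite map_inj_uniq// enum_uniq. Qed.

Let zs1 : in_disc zs.
Proof. by move=> _ /mapP[k _ ->]. Qed.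

Let size_zs : size zs = n.
Proof. by rewrite size_map size_enum_ord. Qed.

Let zsP (P : C -> Prop) : (forall k, P (z k)) -> forall x, x \in zs -> P x.
Proof. by move=> H _ /mapP[k _ ->]. Qed.

Let mem_zs k : z k \in zs.
Proof. by apply: map_f; rewrite mem_enum. Qed.

Lemma open_disc : open D.
Proof.
rewrite openE => x /discE x1; apply/nbhs_modulusP; exists (1 - N x); first by lra.
by move=> y yx; apply/discE; have := modulusBr y x; lra.
Qed.

Lemma hol_discP (f : C -> C) : hol_disc D f <-> holo_disc f /\ forall x, N x < 1 -> N (f x) < 1.
Proof.
by split=> -[hf f1]; split=> x /discE x1; [exact: hf|exact/discE/f1|exact: hf|exact/discE/f1].
Qed.

(** Dividing by [rho] between the bound and 1 yields an admissible function whose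
    values at the nodes are further apart by [mobius_scale_lt]. *)
Lemma strict_solution_lt (g : C -> C) (i j : 'I_n) : holo_disc g -> strictly_bounded g ->
  (forall k, g (z k) = w k) -> w i <> w j ->
  mobius (w i) (w j) < pick_dist D z w i j.
Proof.
move=> hg [r r1 gr] gw wij.
have r0 : 0 <= r by apply: le_trans (gr _ (z1 i)); exact: modulus_ge0.
pose rho := (r + 1) / 2; have rho1 : rho < 1 by rewrite /rho; lra.
have rho_gt : r < rho by rewrite /rho; lra.
have rho0 : 0 < rho by lra.
pose c : C := real_complex R rho.
have Nc : N c = rho by rewrite modulusR gtr0_norm.
have c0 : c != 0 by rewrite -modulus_gt0 Nc.
have g1 x : N x < 1 -> N (c^-1 * g x) < 1.
  move=> x1; rewrite modulusM modulusV Nc ltr_pdivrMl// mulr1.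
  by apply: le_lt_trans (gr x x1) _.
have zD k : D (z k) by exact/discE.
have hcg : hol_disc D (fun x => c^-1 * g x).
  apply/hol_discP; split; last exact: g1.
  by move=> x x1; apply: holoM; [exact: holo_cst|exact: hg].
have cgw k : c^-1 * g (z k) = c^-1 * w k by rewrite gw.
have := pick_dist_ge zD i j hcg cgw; rewrite !gw; apply: lt_le_trans.
have N1 k : N (c^-1 * w k) < 1 by rewrite -gw; exact: g1.
have := @mobius_scale_lt R c (c^-1 * w i) (c^-1 * w j).
rewrite !mulVKf// Nc; apply=> //.
by move=> /(mulfI (invr_neq0 c0)).
Qed.

(** Both directions go through the absence of strictly bounded solutions. *)
Lemma extremal_iff_blaschke :
  (exists i j, w i <> w j /\ mobius (w i) (w j) = pick_dist D z w i j) <->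
  (exists (k : nat) (B : C -> C),
     [/\ blaschke k B, (k <= n - 1)%N,
         exists x y, [/\ disc x, disc y & B x <> B y] &
         forall j, B (z j) = w j]).
Proof.
split.
  move=> [i [j [wij md]]].
  have zD k : D (z k) by exact/discE.
  have mle : mobius (w i) (w j) <= pick_dist D z w i j by rewrite md.
  have [f [hf f1 fw]] := closed_disc_solution zD w1 open_disc wij mle.
  have hf' : holo_disc f by move=> x /discE/hf.
  have f1' : bounded_disc f 1 by move=> x /discE/f1.
  have zs0 : (0 < size zs)%N by rewrite size_zs.
  have nstrict : ~ exists g, [/\ holo_disc g, strictly_bounded g & forall x, x \in zs -> g x = f x].
    move=> [g [hg gs gE]].
    have gw k : g (z k) = w k by rewrite gE.
    by have := strict_solution_lt hg gs gw wij; rewrite md ltxx.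
  have [c [s [c1 s1 ss sE]]] := schur_algorithm zs_uniq zs1 zs0 hf' f1' nstrict.
  exists (size s), (bprod c s); split.
  - by apply/blaschkeP; exists c, s.
  - by move: ss; rewrite size_zs; case: (n) n_gt0 => // m _; rewrite subn1.
  - exists (z i), (z j); split; [exact: zD|exact: zD|].
    by rewrite -!sE// !fw.
  - by move=> k; rewrite -sE.
move=> [k [B [/blaschkeP[c [s [c1 s1 sk BE]]] kn _ Bw]]].
have ss : (size s < size zs)%N.
  by rewrite size_zs sk; apply: leq_ltn_trans kn _; rewrite subn1 prednK.
have nstrict (g : C -> C) : holo_disc g -> strictly_bounded g -> ~ (forall k, g (z k) = w k).
  move=> hg gs gw; apply: (blaschke_not_strict c1 s1 zs_uniq zs1 ss hg gs).
  by apply: zsP => l; rewrite gw -BE// Bw.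
have s0 : s != [::].
  apply/eqP => s0; have := w1 (Ordinal n_gt0); rewrite -Bw BE//.
  by rewrite s0 /bprod big_nil mulr1 c1 ltxx.
have [wc|] := pselect (forall i j, w i = w j).
  exfalso; apply: (nstrict (fun=> w (Ordinal n_gt0))).
  - by move=> x x1; exact: holo_cst.
  - by exists (N (w (Ordinal n_gt0))).
  - by move=> l; exact: wc.
move=> /existsNP[i /existsNP[j wij]]; exists i, j; split=> //.
apply/eqP; rewrite eq_le; apply/andP; split.
  have bw l : bprod c s (z l) = w l by rewrite -BE// Bw.
  rewrite -{1}(bw i) -{1}(bw j).
  apply: (@pick_dist_ge R C^o D n z w _ (bprod c s) 1).
  - by move=> l; exact/discE.
  - by apply/hol_discP; split; [exact: holo_bprod|move=> x; exact: bprod_lt1].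
  - by move=> l; rewrite mul1r.
rewrite leNgt; apply/negP => /pick_dist_lt_ex[f [d [/hol_discP[hf f1] fd]]].
rewrite !fd => mlt.
have d1 : 1 < N d.
  rewrite ltNge; apply/negP => d1; move: mlt; rewrite ltNge => /negP; apply.
  exact: mobius_scale_le.
have d0 : d != 0 by rewrite -modulus_gt0; lra.
apply: (nstrict (fun x => d^-1 * f x)).
- by move=> x x1; apply: holoM; [exact: holo_cst|exact: hf].
- exists (N d)^-1; first by rewrite invf_lt1//; lra.
  move=> x x1; rewrite modulusM modulusV ler_piMr ?invr_ge0 ?modulus_ge0//.
  exact/ltW/f1.
- by move=> l; rewrite fd mulKf.
Qed.

End Disc.
End SchurAlgorithm.

Theorem theorem2p5 (R : realType) (n : nat) (w : 'I_n -> R[i])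
    (n_gt0 : (0 < n)%N) (w_disc : forall j, disc (w j)) :
  (forall (m : nat) (Omega : set 'rV[R[i]]_m) (z : 'I_n -> 'rV[R[i]]_m),
     (0 < m)%N -> domain Omega -> caratheodory_hyperbolic Omega ->
     (forall j, Omega (z j)) -> injective z ->
     pick_solvable Omega z w <->
     (forall i j, w i = w j) \/
     (exists i j, w i <> w j /\ mobius (w i) (w j) <= pick_dist Omega z w i j))
  /\
  (forall z : 'I_n -> R[i]^o,
     (forall j, disc (z j)) -> injective z ->
     (exists i j,
        w i <> w j /\ mobius (w i) (w j) = pick_dist (@disc R : set R[i]^o) z w i j)
     <->
     (exists (k : nat) (B : R[i] -> R[i]),
        [/\ blaschke k B, (k <= n - 1)%N,
            exists x y, [/\ disc x, disc y & B x <> B y] &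
            forall j, B (z j) = w j])).
Proof.
have w1 k : modulus (w k) < 1 by exact/discE.
split=> [m Omega z _ dO _ zO _|z z1 z_inj].
  exact: pick_criterion.
have z1' k : modulus (z k) < 1 by exact/discE.
exact: extremal_iff_blaschke.
Qed.
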